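(* Let $R$ be an associative ring, and let $\mathsf{FpProj}$ denote the class of all fp-projective $R$-modules. Then every $\mathsf{FpProj}$-periodic $R$-module is weakly fp-projective. That is, if $0\to M\to A\to M\to 0$ is a short exact sequence of $R$-modules with $A$ fp-projective, then $M$ is weakly fp-projective.
   Context: Rings are associative and unital; ''$R$-module'' means a right $R$-module (or a left one, with the side fixed throughout). An $R$-module $J$ is fp-injective if $\operatorname{Ext}^1_R(T,J)=0$ for all finitely presented $R$-modules $T$. An $R$-module $P$ is fp-projective if $\operatorname{Ext}^1_R(P,J)=0$ for all fp-injective $R$-modules $J$. An $R$-module $J$ is strongly fp-injective if $\operatorname{Ext}^n_R(T,J)=0$ for all finitely presented $R$-modules $T$ and all $n\ge 1$. An $R$-module $P$ is weakly fp-projective if $\operatorname{Ext}^1_R(P,J)=0$ for all strongly fp-injective $R$-modules $J$. For a class of modules $\mathsf A$, a module $M$ is $\mathsf A$-periodic if there is a short exact sequence $0\to M\to A\to M\to 0$ with $A\in\mathsf A$. *)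

(* Defs.v *)
From mathcomp Require Import all_boot all_algebra.

Set Implicit Arguments.
Unset Strict Implicit.
Unset Printing Implicit Defensive.

Local Open Scope ring_scope.

(* Rings are pzRingType (associative, unital, possibly zero) and modules are
   left modules; the right modules over R are the left modules over R^c. *)

Section Modules.
Variable R : pzRingType.

Definition surjective_map (U V : lmodType R) (f : {linear U -> V}) : Prop :=
  forall v, exists u, f u = v.

Definition exact_at (U V W : lmodType R)
    (f : {linear U -> V}) (g : {linear V -> W}) : Prop :=
  forall v, g v = 0 <-> exists u, f u = v.

Definition short_exact (U V W : lmodType R)
    (f : {linear U -> V}) (g : {linear V -> W}) : Prop :=
  [/\ injective f, exact_at f g & surjective_map g].

Definition projective (P : lmodType R) : Prop :=
  forall (U V : lmodType R) (p : {linear U -> V}) (f : {linear P -> V}),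
    surjective_map p -> exists h : {linear P -> U}, forall x, p (h x) = f x.

Record projective_resolution (T : lmodType R) := ProjectiveResolution {
  res_obj : nat -> lmodType R;
  res_diff : forall n, {linear res_obj n.+1 -> res_obj n};
  res_aug : {linear res_obj 0%N -> T};
  res_projective : forall n, projective (res_obj n);
  res_aug_surj : surjective_map res_aug;
  res_exact0 : exact_at (res_diff 0%N) res_aug;
  res_exact : forall n, exact_at (res_diff n.+1) (res_diff n)
}.

Section Ext.
Variables (T J : lmodType R) (P : projective_resolution T).

Definition is_cocycle (n : nat) (c : {linear res_obj P n -> J}) : Prop :=
  forall x, c (res_diff P n x) = 0.

Definition is_coboundary (n : nat) : {linear res_obj P n -> J} -> Prop :=
  match n with
  | 0%N => fun c => forall x, c x = 0
  | m.+1 => fun c => exists b : {linear res_obj P m -> J},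
                       forall x, c x = b (res_diff P m x)
  end.

End Ext.

(* Ext^n_R(T, J) = 0, where Ext^n_R(T, J) is the n-th cohomology group of the
   complex Hom_R(P, J) for a projective resolution P of T. The choice of P
   does not matter, and P always exists since every module is a quotient of a
   free one. *)
Definition Ext_eq0 (n : nat) (T J : lmodType R) : Prop :=
  forall (P : projective_resolution T) (c : {linear res_obj P n -> J}),
    is_cocycle c -> is_coboundary c.

(* T is the cokernel of a linear map R^m -> R^n. *)
Definition finitely_presented (T : lmodType R) : Prop :=
  exists (m n : nat) (f : {linear 'rV[R]_m -> 'rV[R]_n})
         (g : {linear 'rV[R]_n -> T}),
    exact_at f g /\ surjective_map g.

Definition fp_injective (J : lmodType R) : Prop :=
  forall T : lmodType R, finitely_presented T -> Ext_eq0 1%N T J.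

Definition fp_projective (P : lmodType R) : Prop :=
  forall J : lmodType R, fp_injective J -> Ext_eq0 1%N P J.

Definition strongly_fp_injective (J : lmodType R) : Prop :=
  forall (T : lmodType R) (n : nat),
    finitely_presented T -> (1 <= n)%N -> Ext_eq0 n T J.

Definition weakly_fp_projective (P : lmodType R) : Prop :=
  forall J : lmodType R, strongly_fp_injective J -> Ext_eq0 1%N P J.

Definition periodic (C : lmodType R -> Prop) (M : lmodType R) : Prop :=
  exists (A : lmodType R) (f : {linear M -> A}) (g : {linear A -> M}),
    C A /\ short_exact f g.

End Modules.

(* Main.v *)
Require Import Defs.
From HB Require Import structures.
From mathcomp Require Import all_boot all_algebra.
From mathcomp Require Import boolp classical_sets.

Set Implicit Arguments.
Unset Strict Implicit.
Unset Printing Implicit Defensive.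

Import GRing.Theory.
Local Open Scope ring_scope.

(* Writing phi = f g on A, one has phi^2 = 0. Given u : M -> J, embed J into
   injectives to get a coresolution J -> I_0 -> I_1 -> ..., whose cosyzygies are
   again strongly fp-injective. On X = J * prod_n I_n the differential d is exact
   and has an fp-injective kernel, and u yields h : A -> X with h phi = d h and
   first component u g. If h = d s + s phi, then u g = s_0 f g for the component
   s_0 : A -> J of s, so s_0 extends u along f.

   To get the homotopy s, present A as a summand of a module Q obtained by
   attaching finitely presented cells. The right-hand sides of a cell involve
   only finitely many earlier generators, so every set of cells closed under
   dependency spans a submodule of Q, and adding one cell to such a set is an
   extension by a finitely presented module. A Zorn argument reduces the
   existence of s to countably many such extensions, over which solvability of
   finite linear systems in ker d suffices. *)

(** * Submodules and finite linear combinations *)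

(** In other words, [(A, phi)] and [(X, d)] are differential modules, [h] is a morphism between them
    and [s] a null-homotopy. Periodicity is what produces [h]: the sequence M -> A -> M maps to each
    extension of a cosyzygy by the next one, and the right end of one such map is the left end of
    the following one. Taking the product puts all degrees into a single equation, whose component 0
    contains no term [d s].

    The obstacle is that [phi] need not respect any filtration of Q. Closing a cellular submodule
    under [phi] takes countably many enlargements C_k, and the sums C_k + phi(C_k) met on the way
    are not known to be cellular. Every extension of the homotopy therefore passes through a larger
    cellular submodule that is finitely presented over both of the sums involved.

    Q comes from a small object argument compressed into one inductive type: each compatible finite
    system in the kernel of Q -> A is itself the datum of a cell, so the kernel is fp-injective and
    an fp-projective A splits off. Since right-hand sides are finite, every cell has finite height
    and no transfinite iteration occurs. *)

Section LinearMaps.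
Variable R : pzRingType.

Lemma linear_exists (U V : lmodType R) (f : U -> V) :
  linear f -> exists g : {linear U -> V}, g =1 f.
Proof.
move=> lin_f; pose g : {linear U -> V} :=
  HB.pack f (GRing.isLinear.Build R U V *:%R f lin_f).
by exists g.
Qed.

Definition submodule (V : lmodType R) (P : V -> Prop) : Prop :=
  P 0 /\ forall a x y, P x -> P y -> P (a *: x + y).

Definition linear_on (U V : lmodType R) (P : U -> Prop) (f : U -> V) : Prop :=
  forall a x y, P x -> P y -> f (a *: x + y) = a *: f x + f y.

Lemma submodule0 (V : lmodType R) (P : V -> Prop) : submodule P -> P 0.
Proof. by case. Qed.

Lemma submoduleD (V : lmodType R) (P : V -> Prop) x y :
  submodule P -> P x -> P y -> P (x + y).
Proof. by move=> [_ +] Px Py => /(_ 1 x y Px Py); rewrite scale1r. Qed.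

Lemma submoduleZ (V : lmodType R) (P : V -> Prop) a x :
  submodule P -> P x -> P (a *: x).
Proof. by move=> [P0 +] Px => /(_ a x 0 Px P0); rewrite addr0. Qed.

Lemma submoduleN (V : lmodType R) (P : V -> Prop) x :
  submodule P -> P x -> P (- x).
Proof. by move=> sP Px; rewrite -scaleN1r; apply: submoduleZ. Qed.

Lemma submoduleB (V : lmodType R) (P : V -> Prop) x y :
  submodule P -> P x -> P y -> P (x - y).
Proof. by move=> sP Px Py; apply: submoduleD => //; apply: submoduleN. Qed.

Lemma submodule_sum (V : lmodType R) (P : V -> Prop) (I : Type) (s : seq I)
    (F : I -> V) : submodule P -> (forall i, P (F i)) -> P (\sum_(i <- s) F i).
Proof.
move=> sP PF; elim: s => [|i s IH]; first by rewrite big_nil; case: sP.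
by rewrite big_cons; apply: submoduleD.
Qed.

Section LinearOn.
Variables (U V : lmodType R) (P : U -> Prop) (f : U -> V).
Hypotheses (sP : submodule P) (lf : linear_on P f).

Lemma linear_on0 : f 0 = 0.
Proof.
case: sP => P0 _; have := lf 1 P0 P0.
rewrite !scale1r addr0 => h; apply: (addrI (f 0)); by rewrite addr0.
Qed.

Lemma linear_onD x y : P x -> P y -> f (x + y) = f x + f y.
Proof. by move=> Px Py; have := lf 1 Px Py; rewrite !scale1r. Qed.

Lemma linear_onZ a x : P x -> f (a *: x) = a *: f x.
Proof.
by move=> Px; have := lf a Px (submodule0 sP); rewrite linear_on0 !addr0.
Qed.

Lemma linear_onN x : P x -> f (- x) = - f x.
Proof. by move=> Px; rewrite -scaleN1r linear_onZ // scaleN1r. Qed.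

End LinearOn.

Definition comb (V : lmodType R) n (c : 'rV[R]_n) (z : 'I_n -> V) : V :=
  \sum_(i < n) c 0 i *: z i.

Section Comb.
Variables (V : lmodType R) (n : nat).
Implicit Types (c : 'rV[R]_n) (z : 'I_n -> V).

Lemma comb_linear z : linear (fun c => comb c z).
Proof.
move=> a c d; rewrite /comb scaler_sumr -big_split /=.
by apply: eq_bigr => i _; rewrite !mxE scalerDl scalerA.
Qed.

Lemma comb0 z : comb 0 z = 0.
Proof. by rewrite /comb big1 // => i _; rewrite mxE scale0r. Qed.

Lemma combD c d z : comb (c + d) z = comb c z + comb d z.
Proof. by have := comb_linear z 1 c d; rewrite !scale1r. Qed.

Lemma combZ a c z : comb (a *: c) z = a *: comb c z.
Proof. by have := comb_linear z a c 0; rewrite !addr0 comb0 addr0. Qed.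

Lemma combN c z : comb (- c) z = - comb c z.
Proof. by rewrite -!scaleN1r combZ. Qed.

Lemma combB c d z : comb (c - d) z = comb c z - comb d z.
Proof. by rewrite combD combN. Qed.

Lemma comb_delta i z : comb (delta_mx 0 i) z = z i.
Proof.
rewrite /comb (bigD1 i) //= big1 ?addr0 => [|j ji].
  by rewrite mxE !eqxx scale1r.
by rewrite mxE (negPf ji) scale0r.
Qed.

Lemma combDr c z z' : comb c (fun i => z i + z' i) = comb c z + comb c z'.
Proof. by rewrite -big_split; apply: eq_bigr => i _; rewrite scalerDr. Qed.

Lemma combNr c z : comb c (fun i => - z i) = - comb c z.
Proof. by rewrite -sumrN; apply: eq_bigr => i _; rewrite scalerN. Qed.

Lemma combBr c z z' : comb c (fun i => z i - z' i) = comb c z - comb c z'.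
Proof. by rewrite combDr combNr. Qed.

Lemma eq_comb c z z' : z =1 z' -> comb c z = comb c z'.
Proof. by move=> zz; apply: eq_bigr => i _; rewrite zz. Qed.

Lemma comb_mul m (b : 'rV[R]_m) (r : 'M[R]_(m, n)) z :
  comb (b *m r) z = comb b (fun j => comb (row j r) z).
Proof.
rewrite /comb; under eq_bigr do rewrite mxE scaler_suml.
rewrite exchange_big; apply: eq_bigr => j _ /=.
by rewrite scaler_sumr; apply: eq_bigr => i _; rewrite mxE scalerA.
Qed.

Lemma comb_submodule (P : V -> Prop) c z :
  submodule P -> (forall i, P (z i)) -> P (comb c z).
Proof.
by move=> sP Pz; apply: submodule_sum => // i; apply: submoduleZ.
Qed.

End Comb.

Lemma comb_row_mx (V : lmodType R) n1 n2 (c : 'rV[R]_n1) (d : 'rV[R]_n2)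
    (z : 'I_n1 -> V) (z' : 'I_n2 -> V) :
  comb (row_mx c d)
    (fun i => match fintype.split i with inl j => z j | inr k => z' k end)
  = comb c z + comb d z'.
Proof.
rewrite /comb big_split_ord /=; congr (_ + _); apply: eq_bigr => i _.
  by rewrite row_mxEl (unsplitK (inl i)).
by rewrite row_mxEr (unsplitK (inr i)).
Qed.

Lemma linear_on_comb (U V : lmodType R) (P : U -> Prop) (f : U -> V) n
    (c : 'rV[R]_n) z : submodule P -> linear_on P f -> (forall i, P (z i)) ->
  f (comb c z) = comb c (f \o z).
Proof.
move=> sP lf Pz; rewrite /comb.
elim: (index_enum _) => [|i s IH]; first by rewrite !big_nil (linear_on0 sP).
rewrite !big_cons (linear_onD lf) ?IH ?(linear_onZ sP lf) //.
  exact: submoduleZ.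
by apply: submodule_sum => // j; apply: submoduleZ.
Qed.

Lemma linear_comb (U V : lmodType R) (f : {linear U -> V}) n
    (c : 'rV[R]_n) z : f (comb c z) = comb c (f \o z).
Proof.
by rewrite /comb linear_sum; apply: eq_bigr => i _; rewrite linearZ.
Qed.

End LinearMaps.

(** * Quotients, free modules and submodules *)

Section Constructions.
Variable R : pzRingType.

Lemma lmodule_exists (T : Type) (zero : T) (opp : T -> T) (add : T -> T -> T)
    (scale : R -> T -> T) :
  associative add -> commutative add -> left_id zero add ->
  left_inverse zero opp add ->
  (forall a b x, scale a (scale b x) = scale (a * b) x) ->
  left_id 1 scale -> right_distributive scale add ->
  (forall x, {morph scale^~ x : a b / a + b >-> add a b}) ->
  exists (V : lmodType R) (f : T -> V) (g : V -> T),
    [/\ cancel f g, cancel g f, forall x y, f (add x y) = f x + f y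
      & forall a x, f (scale a x) = a *: f x].
Proof.
move=> addA addC add0 addN scA sc1 scDr scDl.
pose C : choiceType := HB.pack T (gen_eqMixin T) (gen_choiceMixin T).
pose Z : zmodType := HB.pack C (GRing.isZmodule.Build C addA addC add0 addN).
pose V : lmodType R := HB.pack Z
  (GRing.Zmodule_isLmodule.Build R Z scA sc1 scDr scDl).
by exists V, id, id.
Qed.

(** The laws are asked only up to [E], so that a carrier such as lists of scaled generators
    qualifies. Classes are the predicates [E x], and the operations go through chosen
    representatives. *)
Lemma quotient_lmodule_exists (W : Type) (E : W -> W -> Prop) (zero : W)
    (opp : W -> W) (add : W -> W -> W) (scale : R -> W -> W) :
  (forall x, E x x) -> (forall x y, E x y -> E y x) ->
  (forall x y z, E x y -> E y z -> E x z) ->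
  (forall x x' y y', E x x' -> E y y' -> E (add x y) (add x' y')) ->
  (forall x x', E x x' -> E (opp x) (opp x')) ->
  (forall a x x', E x x' -> E (scale a x) (scale a x')) ->
  (forall x y z, E (add x (add y z)) (add (add x y) z)) ->
  (forall x y, E (add x y) (add y x)) ->
  (forall x, E (add zero x) x) ->
  (forall x, E (add (opp x) x) zero) ->
  (forall a b x, E (scale a (scale b x)) (scale (a * b) x)) ->
  (forall x, E (scale 1 x) x) ->
  (forall a x y, E (scale a (add x y)) (add (scale a x) (scale a y))) ->
  (forall a b x, E (scale (a + b) x) (add (scale a x) (scale b x))) ->
  exists (V : lmodType R) (f : W -> V),
    [/\ forall v, exists x, f x = v, forall x y, f x = f y <-> E x y,
        forall x y, f (add x y) = f x + f y
      & forall a x, f (scale a x) = a *: f x].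
Proof.
move=> Er Es Et Eadd Eopp Esc addA addC add0 addN scA sc1 scDr scDl.
pose T := {A : W -> Prop | exists x, A = E x}.
pose pi (x : W) : T := exist _ (E x) (ex_intro _ x erefl).
have piE x y : pi x = pi y <-> E x y.
  split=> [/(congr1 sval) /= ->|Exy]; first exact: Er.
  apply: eq_exist; apply: funext => z; apply/propext.
  by split=> h; apply: Et h => //; apply: Es.
have piP (t : T) : exists x, pi x = t.
  by case: t => A [x xE]; exists x; apply: eq_exist; rewrite xE.
pose rep t := sval (cid (piP t)).
have repK t : pi (rep t) = t by rewrite /rep; case: cid.
have Erep x : E (rep (pi x)) x by apply/piE/repK.
pose add' s t := pi (add (rep s) (rep t)).
pose opp' s := pi (opp (rep s)).
pose scale' a s := pi (scale a (rep s)).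
have addE x y : add' (pi x) (pi y) = pi (add x y) by apply/piE/Eadd.
have oppE x : opp' (pi x) = pi (opp x) by apply/piE/Eopp.
have scaleE a x : scale' a (pi x) = pi (scale a x) by apply/piE/Esc.
have [||||||||V [f [g [fK gK fD fZ]]]] :=
    @lmodule_exists T (pi zero) opp' add' scale'.
- move=> s t u; have [[[x <-] [y <-]] [z <-]] := (piP s, piP t, piP u).
  by rewrite !addE; apply/piE.
- by move=> s t; have [[x <-] [y <-]] := (piP s, piP t); rewrite !addE; apply/piE.
- by move=> s; have [x <-] := piP s; rewrite addE; apply/piE.
- by move=> s; have [x <-] := piP s; rewrite oppE addE; apply/piE.
- by move=> a b s; have [x <-] := piP s; rewrite !scaleE; apply/piE.
- by move=> s; have [x <-] := piP s; rewrite scaleE; apply/piE.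
- move=> a s t; have [[x <-] [y <-]] := (piP s, piP t).
  by rewrite addE !scaleE addE; apply/piE.
- move=> s a b; have [x <-] := piP s.
  by rewrite !scaleE addE; apply/piE.
exists V, (f \o pi); split=> [v|x y|x y|a x] /=.
- by have [x xE] := piP (g v); exists x; rewrite xE gK.
- by split=> [/(can_inj fK)/piE|/piE ->].
- by rewrite -addE fD.
- by rewrite -scaleE fZ.
Qed.

Lemma quotient_exists (V : lmodType R) (N : V -> Prop) : submodule N ->
  exists (W : lmodType R) (q : {linear V -> W}),
    surjective_map q /\ forall x, q x = 0 <-> N x.
Proof.
move=> sN; pose E x y := N (x - y).
have N0 := submodule0 sN.
have EE x y : x = y -> E x y by move=> ->; rewrite /E subrr.
have [||||||||||||||W [q [qs qE qD qZ]]] :=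
    @quotient_lmodule_exists V E 0 -%R +%R *:%R.
- by move=> x; apply: EE.
- by move=> x y; rewrite /E => h; rewrite -opprB; apply: submoduleN.
- move=> x y z; rewrite /E => h1 h2.
  by rewrite -(subrKA y); apply: submoduleD.
- move=> x x' y y'; rewrite /E => h1 h2.
  by rewrite opprD addrACA; apply: submoduleD.
- by move=> x x' h; rewrite /E -opprD; apply: submoduleN.
- by move=> a x x' h; rewrite /E -scalerBr; apply: submoduleZ.
- by move=> x y z; apply/EE/addrA.
- by move=> x y; apply/EE/addrC.
- by move=> x; apply/EE/add0r.
- by move=> x; apply/EE/addNr.
- by move=> a b x; apply/EE/scalerA.
- by move=> x; apply/EE/scale1r.
- by move=> a x y; apply/EE/scalerDr.
- by move=> a b x; apply/EE/scalerDl.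
have [|g gE] := @linear_exists R V W q.
  by move=> a x y; rewrite qD qZ.
exists W, g; split=> [w|x]; first by have [x <-] := qs w; exists x.
have q0 : q 0 = 0 by rewrite -(scale0r (0 : V)) qZ scale0r.
by rewrite gE -q0 qE /E subr0.
Qed.

Definition eval_word (T : Type) (V : lmodType R) (v : T -> V)
  (w : seq (R * T)) : V := \sum_(p <- w) p.1 *: v p.2.

(** Words are identified when they have the same value under every map to every module. The module
    laws and the universal property then follow by evaluation, without normal forms or decidable
    equality on [T]. *)
Lemma free_exists (T : Type) : exists (F : lmodType R) (b : T -> F),
  (forall x, exists w, x = eval_word b w) /\
  (forall (V : lmodType R) (v : T -> V),
     exists f : {linear F -> V}, forall t, f (b t) = v t).
Proof.
pose E (w w' : seq (R * T)) :=
  forall (V : lmodType R) (v : T -> V), eval_word v w = eval_word v w'.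
pose sc a (w : seq (R * T)) := [seq (a * p.1, p.2) | p <- w].
have evD (V : lmodType R) (v : T -> V) w w' :
  eval_word v (w ++ w') = eval_word v w + eval_word v w' by exact: big_cat.
have evZ (V : lmodType R) (v : T -> V) a w :
    eval_word v (sc a w) = a *: eval_word v w.
  rewrite /eval_word big_map scaler_sumr.
  by apply: eq_bigr => p _; rewrite scalerA.
have [||||||||||||||F [q [qs qE qD qZ]]] :=
    @quotient_lmodule_exists (seq (R * T)) E [::] (sc (-1)) cat sc.
- by [].
- by move=> x y h V v; rewrite h.
- by move=> x y z h1 h2 V v; rewrite h1 h2.
- by move=> x x' y y' h1 h2 V v; rewrite !evD h1 h2.
- by move=> x x' h V v; rewrite !evZ h.
- by move=> a x x' h V v; rewrite !evZ h.
- by move=> x y z V v; rewrite !evD addrA.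
- by move=> x y V v; rewrite !evD addrC.
- by [].
- by move=> x V v; rewrite evD evZ scaleN1r addNr /eval_word big_nil.
- by move=> a b x V v; rewrite !evZ scalerA.
- by move=> x V v; rewrite evZ scale1r.
- by move=> a x y V v; rewrite !(evZ, evD) scalerDr.
- by move=> a b x V v; rewrite !(evZ, evD) scalerDl.
pose b t := q [:: (1, t)].
have qw w : q w = eval_word b w.
  elim: w => [|p w IH].
    have q0 : q (sc 0 [::]) = 0 by rewrite qZ scale0r.
    by rewrite /eval_word big_nil -[RHS]q0.
  rewrite /eval_word big_cons -/(eval_word b w) -IH -cat1s qD.
  by congr (_ + _); rewrite /b -qZ /sc /= mulr1; case: p.
exists F, b; split=> [x|V v]; first by have [w <-] := qs x; exists w.
pose rep x := sval (cid (qs x)).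
have repK x : q (rep x) = x by rewrite /rep; case: cid.
have ev_rep w : eval_word v (rep (q w)) = eval_word v w.
  by move/qE: (repK (q w)); apply.
have [|f fE] := @linear_exists R F V (fun x => eval_word v (rep x)).
  move=> a x y; rewrite -{1}(repK x) -{1}(repK y) -qZ -qD ev_rep.
  by rewrite evD evZ.
by exists f => t; rewrite fE ev_rep /eval_word big_seq1 scale1r.
Qed.

Lemma linear_factor (U V W : lmodType R) (q : {linear U -> V})
    (f : {linear U -> W}) :
  surjective_map q -> (forall x, q x = 0 -> f x = 0) ->
  exists g : {linear V -> W}, forall x, g (q x) = f x.
Proof.
move=> qs qf; pose rep x := sval (cid (qs x)).
have repK x : q (rep x) = x by rewrite /rep; case: cid.
have fE x y : q x = q y -> f x = f y.
  move=> h; apply/eqP; rewrite -subr_eq0 -linearB; apply/eqP/qf.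
  by rewrite linearB h subrr.
have [|g gE] := @linear_exists R V W (f \o rep).
  by move=> a x y /=; rewrite -linearP; apply: fE; rewrite linearP !repK.
by exists g => x; rewrite gE; apply: fE.
Qed.

(** The module is the free module on the elements of [P] modulo the kernel of its evaluation in [V];
    this reuses quotients instead of structures on a subtype. *)
Lemma submodule_exists (V : lmodType R) (P : V -> Prop) : submodule P ->
  exists (U : lmodType R) (i : {linear U -> V}),
    injective i /\ forall x, P x <-> exists u, i u = x.
Proof.
move=> sP; have [F [b [bw bu]]] := free_exists {x | P x}.
have [f fb] := bu V sval.
have sker : submodule (fun x => f x = 0).
  by split=> [|a x y fx fy]; rewrite ?linear0 // linearP fx fy scaler0 addr0.
have [U [q [qs qE]]] := quotient_exists sker.
have [i iq] := @linear_factor F U V q f qs (fun x => (qE x).1).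
exists U, i; split=> [u u' h|x].
  have [x xE] := qs (u - u'); apply/eqP; rewrite -subr_eq0 -xE.
  by apply/eqP/qE; rewrite -iq xE linearB h subrr.
split=> [Px|[u <-]].
  by exists (q (b (exist _ x Px))); rewrite iq fb.
have [y <-] := qs u; rewrite iq; have [w ->] := bw y.
rewrite /eval_word linear_sum; apply: submodule_sum => // p.
by rewrite linearZ fb; apply: submoduleZ => //; case: (p.2).
Qed.

End Constructions.

(** * Relative finite presentation and linear systems *)

Section Extensions.
Variable R : pzRingType.

(** A linear relation is single-valued as soon as it is so over 0. Maps are defined below by such
    relations, which reduces well-definedness to one check; outside [E] the value is 0 by
    default. *)
Lemma graph_function (U V : lmodType R) (E : U -> Prop) (G : U -> V -> Prop) :
  submodule E -> (forall x, E x -> exists y, G x y) ->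
  (forall a x x' y y', G x y -> G x' y' -> G (a *: x + x') (a *: y + y')) ->
  (forall y, G 0 y -> y = 0) ->
  exists f : U -> V, linear_on E f /\ forall x y, E x -> G x y -> f x = y.
Proof.
move=> sE tot lin fun0.
have uniq x y y' : G x y -> G x y' -> y = y'.
  move=> h h'; have := lin (-1) _ _ _ _ h h'.
  rewrite !scaleN1r addNr => /fun0 /eqP.
  by rewrite addrC subr_eq0 => /eqP.
pose f x := if pselect (E x) is left Ex then sval (cid (tot x Ex)) else 0.
have fG x : E x -> G x (f x).
  by move=> Ex; rewrite /f; case: pselect => // Ex'; case: cid.
exists f; split=> [a x y Ex Ey|x y Ex Gxy]; last exact: uniq (fG x Ex) Gxy.
apply: (uniq (a *: x + y)); last by apply: lin; apply: fG.
by apply: fG; case: sE => _; apply.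
Qed.

Lemma graph_linear (U V : lmodType R) (G : U -> V -> Prop) :
  (forall x, exists y, G x y) ->
  (forall a x x' y y', G x y -> G x' y' -> G (a *: x + x') (a *: y + y')) ->
  (forall y, G 0 y -> y = 0) ->
  exists f : {linear U -> V}, forall x y, G x y -> f x = y.
Proof.
move=> tot lin fun0.
have [//|f [flin fG]] := @graph_function U V (fun=> True) G _ (fun x _ => tot x) lin fun0.
have [g gE] := linear_exists (fun a x y => flin a x y I I).
by exists g => x y Gxy; rewrite gE; apply: fG.
Qed.

(** For submodules D of E, this says that E/D is finitely presented, with generators the classes of
    [e] and relations the rows of [r]. Staying with predicates on [Q] avoids forming the
    quotients. *)
Definition fp_over (Q : lmodType R) (D E : Q -> Prop) : Prop :=
  exists n (e : 'I_n -> Q) m (r : 'M[R]_(m, n)),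
    [/\ forall i, E (e i),
        forall x, E x -> exists c y, D y /\ x = comb c e + y
      & forall c, D (comb c e) <-> exists b, c = b *m r].

(* When [P] is a submodule, this says that [P] is an fp-injective module. *)
Definition solvable_on (Z : lmodType R) (P : Z -> Prop) : Prop :=
  forall m n (r : 'M[R]_(m, n)) (t : 'I_m -> Z),
    (forall j, P (t j)) -> (forall c, c *m r = 0 -> comb c t = 0) ->
    exists z : 'I_n -> Z,
      (forall i, P (z i)) /\ forall c, comb (c *m r) z = comb c t.

Section FpOver.
Variables (Q X : lmodType R) (D E : Q -> Prop).
Hypotheses (sD : submodule D) (sE : submodule E) (DE : forall x, D x -> E x).

Lemma glue_linear n (e : 'I_n -> Q) (z : 'I_n -> X) (s : Q -> X) :
  linear_on D s ->
  (forall x, E x -> exists c y, D y /\ x = comb c e + y) ->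
  (forall c, D (comb c e) -> comb c z = s (comb c e)) ->
  exists s' : Q -> X, linear_on E s' /\
    forall c y, E (comb c e + y) -> D y -> s' (comb c e + y) = comb c z + s y.
Proof.
move=> ls gen rel.
pose G x v := exists c y, [/\ D y, x = comb c e + y & v = comb c z + s y].
have [|||s' [ls' s'G]] := @graph_function Q X E G sE.
- move=> x /gen [c [y [Dy ->]]].
  by exists (comb c z + s y), c, y.
- move=> a x x' v v' [c [y [Dy -> ->]]] [c' [y' [Dy' -> ->]]].
  exists (a *: c + c'), (a *: y + y'); split; first by case: sD => _; apply.
    by rewrite combD combZ scalerDr addrACA.
  by rewrite combD combZ ls // scalerDr addrACA.
- move=> v [c [y [Dy + ->]]] => /esym/eqP; rewrite addr_eq0 => /eqP cE.
  have Dc : D (comb c e) by rewrite cE; apply: submoduleN.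
  by rewrite rel // cE (linear_onN sD ls) // addNr.
exists s'; split=> // c y Ec Dy.
by apply: s'G => //; exists c, y.
Qed.

(** The values on the generators [e] have to solve the system with matrix [r] whose right-hand sides
    are the values of [s] on the relations. The system is compatible because [s] is linear on
    [D]. *)
Lemma fp_over_extend (P : X -> Prop) (s : Q -> X) :
  fp_over D E -> submodule P -> solvable_on P ->
  linear_on D s -> (forall x, D x -> P (s x)) ->
  exists s' : Q -> X,
    [/\ linear_on E s', forall x, D x -> s' x = s x & forall x, E x -> P (s' x)].
Proof.
move=> [n [e [m [r [Ee gen rel]]]]] sP solP ls Ps.
have Dr j : D (comb (row j r) e).
  by apply/rel; exists (delta_mx 0 j); rewrite rowE.
have scomb c : s (comb (c *m r) e) = comb c (fun j => s (comb (row j r) e)).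
  by rewrite comb_mul (linear_on_comb _ sD ls).
have [||z [Pz zE]] := solP m n r (fun j => s (comb (row j r) e)).
- by move=> j; apply: Ps.
- by move=> c cr; rewrite -scomb cr comb0 (linear_on0 sD ls).
have [|s' [ls' s'E]] := @glue_linear n e z s ls gen.
  by move=> c /rel [b ->]; rewrite zE scomb.
exists s'; split=> // [x Dx|x Ex].
  by rewrite -[x in LHS]add0r -(comb0 e) s'E ?comb0 ?add0r //; apply: DE.
have [c [y [Dy xE]]] := gen x Ex; rewrite xE s'E -?xE //.
by apply: submoduleD => //; [apply: comb_submodule|apply: Ps].
Qed.

(** Arbitrary preimages [y] of the [w (e i)] disagree with [s] on the relations by elements of ker
    d; solving the system for these errors inside ker d gives the correction [z]. *)
Lemma fp_over_lift (Y : lmodType R) (d : {linear X -> Y}) (w : Q -> Y)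
    (s : Q -> X) :
  fp_over D E -> solvable_on (fun x => d x = 0) ->
  linear_on E w -> (forall x, E x -> exists y, d y = w x) ->
  linear_on D s -> (forall x, D x -> d (s x) = w x) ->
  exists s' : Q -> X,
    [/\ linear_on E s', forall x, D x -> s' x = s x
      & forall x, E x -> d (s' x) = w x].
Proof.
move=> [n [e [m [r [Ee gen rel]]]]] sol lw wd ls ds.
have /choice [y yE] : forall i, exists y, d y = w (e i) by move=> i; apply: wd.
have Dr j : D (comb (row j r) e).
  by apply/rel; exists (delta_mx 0 j); rewrite rowE.
have scomb c : s (comb (c *m r) e) = comb c (fun j => s (comb (row j r) e)).
  by rewrite comb_mul (linear_on_comb _ sD ls).
have dy c : d (comb c y) = w (comb c e).
  rewrite linear_comb (linear_on_comb _ sE lw) //.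
  by apply: eq_comb => i /=.
have [||z [dz zE]] :=
    sol m n r (fun j => s (comb (row j r) e) - comb (row j r) y).
- by move=> j; rewrite linearB dy ds // subrr.
- move=> c cr; rewrite combBr -scomb -comb_mul cr !comb0.
  by rewrite (linear_on0 sD ls) subr0.
have [|s' [ls' s'E]] := @glue_linear n e (fun i => y i + z i) s ls gen.
  move=> c /rel [b ->].
  by rewrite combDr zE combBr -comb_mul -scomb addrC subrK.
exists s'; split=> // [x Dx|x Ex].
  by rewrite -[x in LHS]add0r -(comb0 e) s'E ?comb0 ?add0r //; apply: DE.
have [c [x' [Dx' xE]]] := gen x Ex; rewrite xE s'E -?xE // linearD ds //.
rewrite combDr linearD dy (linear_comb d c z).
have -> : comb c (d \o z) = 0 by rewrite /comb big1 // => i _ /=; rewrite dz scaler0.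
rewrite addr0 xE (linear_onD lw) //; first exact: comb_submodule.
exact: DE.
Qed.

End FpOver.
End Extensions.

(** * Extension of linear maps and Ext *)

Section Resolutions.
Variable R : pzRingType.

Lemma projective_cover (V : lmodType R) :
  exists (P : lmodType R) (p : {linear P -> V}), projective P /\ surjective_map p.
Proof.
have [F [b [bw bu]]] := free_exists R V.
have [p pE] := bu V id.
exists F, p; split=> [U W q f qs|v]; last by exists (b v); rewrite pE.
have /choice [u uE] : forall v, exists y, q y = f (b v) by move=> v; apply: qs.
have [h hE] := bu U u; exists h => x; have [w ->] := bw x.
rewrite /eval_word !linear_sum; apply: eq_bigr => i _.
by rewrite !linearZ hE uE.
Qed.

Lemma kernel_submodule (U V : lmodType R) (f : {linear U -> V}) :
  submodule (fun x => f x = 0).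
Proof.
by split=> [|a x y fx fy]; rewrite ?linear0 // linearP fx fy scaler0 addr0.
Qed.

Lemma image_submodule (U V : lmodType R) (f : {linear U -> V}) (P : U -> Prop) :
  submodule P -> submodule (fun y => exists2 x, P x & y = f x).
Proof.
move=> [P0 PD]; split=> [|a _ _ [x Px ->] [y Py ->]].
  by exists 0; rewrite ?linear0.
by exists (a *: x + y); [apply: PD|rewrite linearP].
Qed.

Record syzygy (U V : lmodType R) (f : {linear U -> V}) := Syzygy {
  syz_obj : lmodType R;
  syz_map : {linear syz_obj -> U};
  syz_projective : projective syz_obj;
  syz_exact : exact_at syz_map f }.

Lemma syzygy_exists (U V : lmodType R) (f : {linear U -> V}) :
  exists s : syzygy f, True.
Proof.
have [K [i [_ iE]]] := submodule_exists (kernel_submodule f).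
have [P [p [projP ps]]] := projective_cover K.
have ex : exact_at (i \o p)%FUN f.
  move=> x; split=> [/iE [y <-]|[y <-]]; last by apply/iE; exists (p y).
  by have [z <-] := ps y; exists z.
by exists (Syzygy projP ex).
Qed.

Definition choose_syzygy (U V : lmodType R) (f : {linear U -> V}) : syzygy f :=
  sval (cid (syzygy_exists f)).

(** Bundling a map with its two ends lets [iter] build a resolution, although the modules change at
    each step. *)
Record arrow := Arrow {
  dom : lmodType R; cod : lmodType R; arr : {linear dom -> cod} }.

Definition next_arrow (a : arrow) : arrow :=
  Arrow (syz_map (choose_syzygy (arr a))).

Lemma resolution_exists (T : lmodType R) : exists P : projective_resolution T, True.
Proof.
have [P0 [p [projP0 ps]]] := projective_cover T.
pose a n := iter n next_arrow (Arrow p).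
have projP n : projective (dom (a n)).
  by case: n => [|n] //; apply: syz_projective.
have ex n : exact_at (arr (a n.+1)) (arr (a n)) by apply: syz_exact.
by exists (@ProjectiveResolution R T (fun n => dom (a n)) (fun n => arr (a n.+1))
  p projP ps (ex 0%N) (fun n => ex n.+1)).
Qed.

Definition extends_to (U V J : lmodType R) (f : {linear U -> V}) : Prop :=
  forall u : {linear U -> J}, exists v : {linear V -> J}, forall x, v (f x) = u x.

(** Comparing a resolution with the extension gives [a] : P_0 -> V and [b] : P_1 -> U. The cocycle
    [u b] is the coboundary of some [c], and V = f(U) + a(P_0), where [u] and [c] agree up to sign
    on the overlap described by P_1. *)
Lemma Ext1_extends (T J U V : lmodType R) (f : {linear U -> V})
    (g : {linear V -> T}) :
  Ext_eq0 1 T J -> short_exact f g -> extends_to J f.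
Proof.
move=> ext [finj fg gs] u; have [P _] := resolution_exists T.
have [a aE] := @res_projective R T P 0 _ _ g (res_aug P) gs.
have [b bE] : exists b : {linear res_obj P 1 -> U},
    forall x, f (b x) = a (res_diff P 0 x).
  have ab x : exists y, f y = a (res_diff P 0 x).
    by apply/fg; rewrite aE; apply/res_exact0; exists x.
  have [|||b bE] := @graph_linear R _ _ (fun x y => f y = a (res_diff P 0 x)).
  - exact: ab.
  - by move=> c x x' y y' h h'; rewrite !linearP h h'.
  - by move=> y; rewrite !linear0 -(linear0 f) => /finj.
  exists b => x; have [y yE] := ab x.
  by rewrite (bE _ _ yE) yE.
have [|c cE] := ext P (u \o b)%FUN.
  move=> x /=; rewrite -(linear0 u); congr (u _); apply: finj.
  rewrite bE linear0 -(linear0 a); congr (a _).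
  by apply/res_exact; exists x.
have [|||v vE] := @graph_linear R V J
    (fun z y => exists x w, z = f x + a w /\ y = u x + c w).
- move=> z; have [w wE] := res_aug_surj P (g z).
  have /fg [x xE] : g (z - a w) = 0 by rewrite linearB aE wE subrr.
  by exists (u x + c w), x, w; rewrite xE subrK.
- move=> k z z' y y' [x [w [-> ->]]] [x' [w' [-> ->]]].
  exists (k *: x + x'), (k *: w + w'); rewrite !linearP !scalerDr.
  by split; rewrite addrACA.
- move=> y [x [w [zE ->]]].
  have : g (f x + a w) = 0 by rewrite -zE linear0.
  rewrite linearD aE (fg _).2 ?add0r; last by exists x.
  move=> /res_exact0 [w' w'E].
  have xE : x = - b w'.
    apply: finj; apply/eqP; rewrite linearN bE w'E -addr_eq0; exact/eqP/esym.
  by rewrite xE -w'E linearN -cE /= addNr.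
exists v => x; apply: vE; exists x, 0; by rewrite !linear0 !addr0.
Qed.

(** A 1-cocycle factors through the image of P_1 in P_0, which is the kernel of the augmentation.
    Extending the resulting map to P_0 exhibits the cocycle as a coboundary. *)
Lemma extends_Ext1 (T J : lmodType R) :
  (forall (U V : lmodType R) (f : {linear U -> V}) (g : {linear V -> T}),
     short_exact f g -> extends_to J f) ->
  Ext_eq0 1 T J.
Proof.
move=> ext P c cc.
have [U [i [iinj iE]]] := submodule_exists (kernel_submodule (res_aug P)).
have [|||u uE] := @graph_linear R U J
    (fun x y => exists2 w, i x = res_diff P 0 w & y = c w).
- move=> x; have /res_exact0 [w wE] : res_aug P (i x) = 0.
    by apply/iE; exists x.
  by exists (c w), w.
- move=> k x x' y y' [w wE ->] [w' w'E ->].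
  by exists (k *: w + w'); rewrite !linearP ?wE ?w'E.
- move=> y [w + ->]; rewrite linear0 => /esym/res_exact [w' <-].
  exact: cc.
have [|v vE] := ext U _ i (res_aug P) _ u.
  split=> //; exact: res_aug_surj.
exists v => w.
have [x xE] : exists x, i x = res_diff P 0 w.
  by apply/iE/res_exact0; exists w.
by rewrite -xE vE; apply/esym/uE; exists w.
Qed.

Definition solvable (J : lmodType R) : Prop := @solvable_on R J (fun=> True).

Lemma mulmx_comb m n (b : 'rV[R]_m) (r : 'M[R]_(m, n)) :
  b *m r = comb b (fun j => row j r).
Proof. by rewrite /comb mulmx_sum_row. Qed.

Lemma comb_basis n (c : 'rV[R]_n) : comb c (delta_mx 0) = c.
Proof. by rewrite [RHS]row_sum_delta. Qed.

Lemma linear_mulmx m n (f : {linear 'rV[R]_m -> 'rV[R]_n}) :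
  exists r : 'M[R]_(m, n), forall b, f b = b *m r.
Proof.
exists (\matrix_j f (delta_mx 0 j)) => b.
rewrite mulmx_comb -{1}[b]comb_basis linear_comb.
by apply: eq_comb => j; rewrite /= rowK.
Qed.

Lemma short_exact_solvable_extends (T J U V : lmodType R) (f : {linear U -> V})
    (g : {linear V -> T}) :
  solvable J -> finitely_presented T -> short_exact f g -> extends_to J f.
Proof.
move=> solJ [m [n [a [p [ap ps]]]]] [finj fg gs] u.
pose D x := exists y, f y = x.
have sT (W : lmodType R) : @submodule R W (fun=> True) by [].
have sD : submodule D.
  split=> [|k _ _ [y <-] [y' <-]]; first by exists 0; rewrite linear0.
  by exists (k *: y + y'); rewrite linearP.
have /choice [e eE] : forall i : 'I_n, exists x, g x = p (delta_mx 0 i).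
  by move=> i; apply: gs.
have [r rE] := linear_mulmx a.
have gcomb c : g (comb c e) = p c.
  by rewrite linear_comb -[in RHS](comb_basis c) linear_comb; apply: eq_comb.
have fpD : fp_over D (fun=> True).
  exists n, e, m, r; split=> // [x _|c].
    have [c cE] := ps (g x); exists c, (x - comb c e).
    split; last by rewrite addrC subrK.
    by apply/fg; rewrite linearB gcomb cE subrr.
  split=> [/fg|[b ->]]; first by rewrite gcomb => /ap [b <-]; exists b.
  by apply/fg; rewrite gcomb; apply/ap; exists b.
have /choice [s sE] : forall x, exists y, D x -> f y = x.
  by move=> x; case: (pselect (D x)) => [[y yx]|]; [exists y|exists 0].
have sf x : s (f x) = x by apply: finj; apply: sE; exists x.
have [|v [lv vE _]] := fp_over_extend sD (sT V) (fun _ _ => I) (s := u \o s) fpD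
  (sT J) solJ _ (fun _ _ => I).
  by move=> k x y [x0 <-] [y0 <-] /=; rewrite -linearP !sf linearP.
have [v' v'E] := linear_exists (fun k x y => lv k x y I I).
by exists v' => x; rewrite v'E vE /= ?sf //; exists x.
Qed.

Lemma solvable_fp_injective (J : lmodType R) : solvable J -> fp_injective J.
Proof.
move=> solJ T fpT; apply: extends_Ext1 => U V f g.
exact: short_exact_solvable_extends.
Qed.

(** Compatibility of [t] makes c r |-> comb c t a map from the row space of [r] to J. The cokernel
    of [r] is finitely presented, so this map extends to R^n, and the images of the basis vectors
    are a solution. *)
Lemma fp_injective_solvable (J : lmodType R) : fp_injective J -> solvable J.
Proof.
move=> fpJ m n r t _ rel.
have [|a aE] := @linear_exists R _ _ (fun b : 'rV[R]_m => b *m r).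
  by move=> k b b'; rewrite mulmxDl scalemxAl.
have sI : submodule (fun c => exists b, a b = c).
  split=> [|k _ _ [b <-] [b' <-]]; first by exists 0; rewrite linear0.
  by exists (k *: b + b'); rewrite linearP.
have [T [q [qs qE]]] := quotient_exists sI.
have [U [i [iinj iE]]] := submodule_exists (kernel_submodule q).
have fpT : finitely_presented T.
  by exists m, n, a, q; split=> // c; apply: qE.
have [|||u uE] := @graph_linear R U J
    (fun x y => exists2 b, i x = b *m r & y = comb b t).
- move=> x; have /qE [b bE] : q (i x) = 0 by apply/iE; exists x.
  by exists (comb b t), b; rewrite -?bE.
- move=> k x x' y y' [b bE ->] [b' b'E ->].
  exists (k *: b + b'); last by rewrite combD combZ.
  by rewrite linearP bE b'E mulmxDl scalemxAl.
- by move=> y [b + ->]; rewrite linear0 => /esym; apply: rel.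
have ex : short_exact i q by split=> // x; split=> /iE.
have [v vE] := Ext1_extends (fpJ T fpT) ex u.
exists (fun k => v (delta_mx 0 k)); split=> // c.
have [x xE] : exists x, i x = c *m r.
  by apply/iE/qE; exists c; rewrite aE.
rewrite -[in LHS](linear_comb v) comb_basis -xE vE.
by apply: uE; exists c.
Qed.

End Resolutions.

(** The hypothesis on chains covers only nonempty ones. Zorn's lemma is therefore applied to the
    members of [P] above [A0] together with the empty set, the union of the empty chain. *)
Lemma Zorn_above (T : Type) (P : set (set T)) (A0 : set T) : P A0 ->
  (forall F : set (set T), subset F P -> total_on F subset -> (exists A, F A) ->
     P (\bigcup_(X in F) X)%classic) ->
  exists A, [/\ P A, subset A0 A & forall B, P B -> subset A B -> subset B A].
Proof.
move=> PA0 chain; pose P' A := A = set0 \/ P A /\ subset A0 A.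
have [F FP tot|A [PA maxA]] := @Zorn_bigcup T P'.
  pose F' : set (set T) := fun A => F A /\ P A /\ subset A0 A.
  have [[B FB]|F'0] := pselect (exists B, F' B); last first.
    left; rewrite -subset0 => x [B FB Bx].
    by case: (FP B FB) => [B0|PB]; [rewrite -B0|case: F'0; exists B].
  have -> : (\bigcup_(X in F) X = \bigcup_(X in F') X)%classic.
    rewrite eqEsubset; split=> x [C]; last by case=> FC _ Cx; exists C.
    move=> FC Cx; exists C => //; split=> //.
    by case: (FP C FC) => // C0; move: Cx; rewrite C0.
  right; split; last by case: (FB) => _ [_ A0B] x A0x; exists B => //; apply: A0B.
  apply: chain => [C [_ []]//|C C' [FC _] [FC' _]|]; first exact: tot.
  by exists B.
case: PA => [A_0|[PA A0A]].
  exists A0; split=> // B PB A0B; have [//|nBA] := pselect (subset B A0).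
  case: (maxA B); last by right.
  rewrite A_0; split=> // B0.
  by apply: nBA => x /B0.
exists A; split=> // B PB AB; have [//|nBA] := pselect (subset B A).
case: (maxA B); first by split.
by right; split=> // x /A0A/AB.
Qed.

(** * Finite generation and finite presentation relative to a submodule *)

Section Finiteness.
Variables (R : pzRingType) (Q : lmodType R).
Implicit Types (D E : Q -> Prop).

Lemma fp_over_refl D : D 0 -> fp_over D D.
Proof.
move=> D0; exists 0%N, (fun=> 0), 0%N, 0; split=> // [x Dx|c].
  by exists 0, x; rewrite comb0 add0r.
split=> _; first by exists 0; apply/matrixP => i [].
by rewrite /comb big_ord0.
Qed.

(** Row j of [r2] yields an element of E, not of D; modulo D it is a combination [a j] of the
    generators [e1]. This explains the block [- A] in the relation matrix of F over D. *)
Lemma fp_over_trans D E F : submodule D -> submodule E -> submodule F ->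
  (forall x, D x -> E x) -> (forall x, E x -> F x) ->
  fp_over D E -> fp_over E F -> fp_over D F.
Proof.
move=> sD sE sF DE EF [n1 [e1 [m1 [r1 [Ee1 gen1 rel1]]]]].
move=> [n2 [e2 [m2 [r2 [Fe2 gen2 rel2]]]]].
have /choice [a aE] : forall j, exists c, D (comb (row j r2) e2 - comb c e1).
  move=> j; have [|c [y [Dy xE]]] := gen1 (comb (row j r2) e2).
    by apply/rel2; exists (delta_mx 0 j); rewrite rowE.
  by exists c; rewrite xE addrC addKr.
pose A : 'M[R]_(m2, n1) := \matrix_j a j.
have DA b : D (comb (b *m r2) e2 - comb (b *m A) e1).
  rewrite !comb_mul -combBr; apply: comb_submodule => // j.
  by rewrite rowK.
exists (n1 + n2)%N,
  (fun i => match fintype.split i with inl j => e1 j | inr k => e2 k end),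
  (m1 + m2)%N, (block_mx r1 0 (- A) r2).
split=> [i|x /gen2 [c2 [y [/gen1 [c1 [z [Dz ->]]] ->]]]|c].
- by case: fintype.split => j //; apply: EF.
- exists (row_mx c1 c2), z; split=> //.
  by rewrite comb_row_mx addrA [comb c2 _ + _]addrC.
rewrite -[c]hsubmxK comb_row_mx; move: (lsubmx c) (rsubmx c) => c1 c2 {c}.
have mulE b1 b2 : row_mx b1 b2 *m block_mx r1 0 (- A) r2
    = row_mx (b1 *m r1 - b2 *m A) (b2 *m r2).
  by rewrite mul_row_block mulmx0 add0r mulmxN.
split=> [Dc|[b]].
  have /rel2 [b2 c2E] : E (comb c2 e2).
    rewrite -[comb c2 e2](addKr (comb c1 e1)) addrC.
    by apply: submoduleB => //; [apply: DE|apply: comb_submodule].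
  have /rel1 [b1 b1E] : D (comb (c1 + b2 *m A) e1).
    have := submoduleB sD Dc (DA b2).
    by rewrite c2E combD opprB addrACA subrr addr0.
  by exists (row_mx b1 b2); rewrite mulE -b1E addrK c2E.
rewrite -[b]hsubmxK mulE => /eq_row_mx [-> ->].
move: (lsubmx b) (rsubmx b) => b1 b2 {b}.
rewrite combB -addrA [- _ + _]addrC; apply: submoduleD => //.
by apply/rel1; exists b1.
Qed.

Definition fg_over D E : Prop :=
  exists n (e : 'I_n -> Q),
    (forall i, E (e i)) /\
    forall x, E x -> exists (c : 'rV[R]_n) y, D y /\ x = comb c e + y.

Lemma fp_over_fg D E : fp_over D E -> fg_over D E.
Proof. by move=> [n [e [m [r [? ? _]]]]]; exists n, e. Qed.

(** E/D' is the quotient of E/D by the finitely generated D'/D: the coordinates of the generators of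
    D' are added to [r] as new rows. *)
Lemma fp_over_quotient D D' E : submodule D -> submodule D' ->
  (forall x, D x -> D' x) -> (forall x, D' x -> E x) ->
  fp_over D E -> fg_over D D' -> fp_over D' E.
Proof.
move=> sD sD' DD' D'E [n [e [m [r [Ee gen rel]]]]] [p [f [D'f genf]]].
have /choice [a aE] : forall k, exists c, D (f k - comb c e).
  move=> k; have [|c [y [Dy fE]]] := gen (f k); first exact: D'E.
  by exists c; rewrite fE addrC addKr.
pose A : 'M[R]_(p, n) := \matrix_k a k.
have DA b : D (comb b f - comb (b *m A) e).
  by rewrite comb_mul -combBr; apply: comb_submodule => // k; rewrite rowK.
exists n, e, (m + p)%N, (col_mx r A); split=> // [x /gen [c [y [Dy ->]]]|c].
  by exists c, y; split=> //; apply: DD'.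
split=> [/genf [c' [y [Dy cE]]]|[b ->]].
  have /rel [b bE] : D (comb (c - c' *m A) e).
    by rewrite combB cE addrAC; apply: submoduleD.
  by exists (row_mx b c'); rewrite mul_row_col -bE subrK.
rewrite -[b]hsubmxK mul_row_col combD; apply: submoduleD => //.
  by apply/DD'/rel; exists (lsubmx b).
rewrite -[comb _ e](subKr (comb (rsubmx b) f)); apply: submoduleB => //.
  exact: comb_submodule.
exact/DD'.
Qed.

Definition submodule_sum2 D E : Q -> Prop :=
  fun x => exists y z, [/\ D y, E z & x = y + z].

Definition linear_image (phi : {linear Q -> Q}) D : Q -> Prop :=
  fun y => exists2 x, D x & y = phi x.

Lemma submodule_sum2P D E : submodule D -> submodule E ->
  submodule (submodule_sum2 D E).
Proof.
move=> [D0 DD] [E0 ED]; split; first by exists 0, 0; rewrite addr0.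
move=> a _ _ [x [y [Dx Ey ->]]] [x' [y' [Dx' Ey' ->]]].
exists (a *: x + x'), (a *: y + y'); split; [exact: DD|exact: ED|].
by rewrite scalerDr addrACA.
Qed.

Lemma fg_over_sum D A B : submodule D -> A 0 -> B 0 ->
  fg_over D A -> fg_over D B -> fg_over D (submodule_sum2 A B).
Proof.
move=> sD A0 B0 [n [e [Ae gene]]] [p [f [Bf genf]]].
exists (n + p)%N,
  (fun i => match fintype.split i with inl j => e j | inr k => f k end).
split=> [i|w [x [x' [/gene [c [y [Dy ->]]] /genf [c' [y' [Dy' ->]]] ->]]]].
  case: fintype.split => j; first by exists (e j), 0; rewrite addr0.
  by exists 0, (f j); rewrite add0r.
exists (row_mx c c'), (y + y'); rewrite comb_row_mx addrACA.
by split=> //; apply: submoduleD.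
Qed.

Lemma fg_over_image (phi : {linear Q -> Q}) D A :
  (forall x, D x -> D (phi x)) -> fg_over D A -> fg_over D (linear_image phi A).
Proof.
move=> phiD [n [e [Ae gen]]]; exists n, (phi \o e); split=> [i|w [x /gen]].
  by exists (e i).
move=> [c [y [Dy ->]]] ->; exists c, (phi y); split; first exact: phiD.
by rewrite linearD linear_comb.
Qed.

End Finiteness.

(** * Homotopies along a filtration *)

Section Homotopy.
Variables (R : pzRingType) (Q X : lmodType R).
Variables (phi : {linear Q -> Q}) (d : {linear X -> X}) (h : {linear Q -> X}).
Hypothesis phi2 : forall x, phi (phi x) = 0.
Hypothesis d_exact : forall x, d x = 0 <-> exists y, d y = x.
Hypothesis solvable_d : solvable_on (fun x => d x = 0).
Hypothesis h_phi : forall x, h (phi x) = d (h x).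
Implicit Types (D E : Q -> Prop) (s : Q -> X).

Definition homotopy_on D s : Prop :=
  linear_on D s /\ forall x, D x -> D (phi x) /\ h x = d (s x) + s (phi x).

(** As phi(D') lies in D, on D' the equation reads d s' = h - s phi with known right-hand side [w].
    Its values lie in ker d, so it extends to E inside ker d because E/D' is finitely presented; as
    ker d = im d, the extension lifts along [d] to a map prolonging [s] because E/D is finitely
    presented. Going through E puts the finiteness conditions on E/D and E/D' rather than on
    D'/D. *)
Lemma homotopy_extend D D' E s :
  submodule D -> submodule D' -> submodule E ->
  (forall x, D x -> D' x) -> (forall x, D' x -> E x) ->
  (forall x, D' x -> D (phi x)) -> fp_over D E -> fp_over D' E ->
  homotopy_on D s ->
  exists s', homotopy_on D' s' /\ forall x, D x -> s' x = s x.
Proof.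
move=> sD sD' sE DD' D'E phiD' fpD fpD' [ls hs].
have DE x : D x -> E x by move=> /DD'/D'E.
pose w x := h x - s (phi x).
have lw : linear_on D' w.
  move=> a x y D'x D'y; rewrite /w !linearP ls; try exact: phiD'.
  by rewrite scalerBr opprD addrACA.
(* The homotopy equation at [phi x] reads h (phi x) = d (s (phi x)), because phi^2 = 0; and h (phi
   x) = d (h x). *)
have dw x : D' x -> d (w x) = 0.
  move=> D'x; rewrite linearB -h_phi (hs _ (phiD' x D'x)).2 phi2.
  by rewrite (linear_on0 sD ls) addr0 subrr.
have [w' [lw' w'E dw']] :=
  fp_over_extend sD' sE D'E fpD' (kernel_submodule d) solvable_d lw dw.
have [|s' [ls' s'E ds']] :=
    fp_over_lift sD sE DE fpD solvable_d lw' (fun x Ex => (d_exact _).1 (dw' x Ex)) ls.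
  by move=> x Dx; rewrite w'E; [rewrite /w (hs x Dx).2 addrK|apply: DD'].

exists s'; split=> //; split=> [a x y D'x D'y|x D'x].
  by apply: ls'; apply: D'E.
split; first exact/DD'/phiD'.
by rewrite ds' ?w'E ?s'E ?subrK //; [apply: phiD'|apply: D'E].
Qed.

(** [L] replaces a filtration with finitely presented factors indexed by ordinals: [L_chain] stands
    for limit steps, and [L_extend] for finitely many successor steps chosen so as to reach a given
    element. *)
Variable L : (Q -> Prop) -> Prop.
Hypothesis L_submodule : forall D, L D -> submodule D.
Hypothesis L_chain : forall F : (Q -> Prop) -> Prop,
  (forall D, F D -> L D) -> (exists D, F D) ->
  (forall D E, F D -> F E ->
     (forall x, D x -> E x) \/ (forall x, E x -> D x)) ->
  L (fun x => exists2 D, F D & D x).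
Hypothesis L_extend : forall D q, L D ->
  exists E, [/\ L E, E q, forall x, D x -> E x & fp_over D E].

Definition fp_above D C : Prop :=
  [/\ L C, forall x, D x -> C x & fp_over D C].

Lemma fp_above_refl D : L D -> fp_above D D.
Proof.
move=> LD; split=> //; apply: fp_over_refl.
exact: submodule0 (L_submodule LD).
Qed.

Lemma fp_above_absorb D C (I : eqType) (t : seq I) (f : I -> Q) :
  L D -> fp_above D C ->
  exists C', [/\ fp_above D C', forall x, C x -> C' x
               & forall i, i \in t -> C' (f i)].
Proof.
move=> LD DC; elim: t => [|i t [C1 [[LC1 DC1 fp1] CC1 tC1]]]; first by exists C.
have [C' [LC' C'q C1C' fp']] := L_extend (f i) LC1.
exists C'; split=> [|x /CC1 /C1C' //|j]; last first.
  by rewrite inE => /orP [/eqP -> //|/tC1 /C1C'].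
split=> // [x /DC1 /C1C' //|].
exact: (fp_over_trans (L_submodule LD) (L_submodule LC1) (L_submodule LC')
  DC1 C1C' fp1 fp').
Qed.

(** C is generated over D by finitely many elements and [phi] preserves D, so absorbing [q] and the
    images of these generators is enough to capture phi(C). *)
Lemma fp_above_next D C q : L D -> (forall x, D x -> D (phi x)) ->
  fp_above D C ->
  exists C', [/\ fp_above D C', C' q, forall x, C x -> C' x
               & forall x, C x -> C' (phi x)].
Proof.
move=> LD phiD DC; have [_ _ /fp_over_fg [n [e [Ce gen]]]] := DC.
have [C1 [DC1 CC1 eC1]] := fp_above_absorb (enum 'I_n) (phi \o e) LD DC.
have [C2 [DC2 C12 qC2]] := fp_above_absorb [:: q] id LD DC1.
have [LC2 D2 _] := DC2.
exists C2; split=> // [|x /CC1 /C12 //|x Cx]; first by apply: qC2; rewrite inE.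
have [c [y [Dy ->]]] := gen x Cx.
rewrite linearD linear_comb; apply: submoduleD; first exact: L_submodule.
  apply: comb_submodule; first exact: L_submodule.
  move=> i; apply: C12; apply: eC1.
  by rewrite mem_enum.
exact/D2/phiD.
Qed.

(* Along an increasing chain with phi(C_k) in C_(k+1), phi maps
   C_k + phi(C_(k+1)) into C_k + phi(C_k), and C_(k+1) + phi(C_(k+1)) into
   C_k + phi(C_(k+1)). Hence the homotopy can be extended along these sums one
   at a time, the term s phi being already known at each step. *)
Lemma homotopy_enlarge D s q : L D -> homotopy_on D s ->
  exists D' s', [/\ L D', homotopy_on D' s', D' q
    & forall x, D x -> D' x /\ s' x = s x].
Proof.
move=> LD hs; have phiD x : D x -> D (phi x) by move=> /hs.2 [].
have sD := L_submodule LD.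
have /choice [nxt nxtP] : forall C : {C | fp_above D C},
    exists C' : {C' | fp_above D C'}, [/\ sval C' q,
      forall x, sval C x -> sval C' x & forall x, sval C x -> sval C' (phi x)].
  move=> [C DC]; have [C' [DC' C'q CC' phiC]] := fp_above_next q LD phiD DC.
  by exists (exist _ C' DC').
pose c k := iter k nxt (exist _ D (fp_above_refl LD)).
pose C k := sval (c k).
have DC k : fp_above D (C k) by apply: svalP.
have sC k : submodule (C k) by apply: L_submodule; case: (DC k).
have CS k x : C k x -> C k.+1 x by have [_ + _] := nxtP (c k); apply.
have phiC k x : C k x -> C k.+1 (phi x) by have [_ _ +] := nxtP (c k); apply.
have Cle j k x : (j <= k)%N -> C j x -> C k x.
  move=> /subnK <-; elim: (k - j)%N => // i IH /IH; exact: CS.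
have C1q : C 1%N q by case: (nxtP (c 0%N)).
pose S i j := submodule_sum2 (C i) (linear_image phi (C j)).
have sS i j : submodule (S i j).
  by apply: submodule_sum2P => //; apply: image_submodule.
have Sle i i' j j' x : (i <= i')%N -> (j <= j')%N -> S i j x -> S i' j' x.
  move=> ii jj [y [_ [Cy [z Cz ->] ->]]].
  exists y, (phi z); split=> //; first exact: Cle Cy.
  by exists z => //; apply: Cle Cz.
have SC i j k x : (i <= k)%N -> (j < k)%N -> S i j x -> C k x.
  move=> ik jk [y [_ [Cy [z Cz ->] ->]]].
  apply: submoduleD => //; first exact: Cle Cy.
  by apply: (Cle j.+1) => //; apply: phiC.
have phiS i j k x : S i j x -> S k i (phi x).
  move=> [y [_ [Cy [z Cz ->] ->]]]; rewrite linearD phi2 addr0.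
  exists 0, (phi y); rewrite add0r; split=> //; first exact: submodule0.
  by exists y.
(* C_k is finitely presented over D, and C_i + phi(C_j) is finitely generated over D, so the
   quotient of C_k by this sum is again finitely presented. The sum itself need not belong to
   [L]. *)
have fpS i j k : (i <= k)%N -> (j < k)%N -> fp_over (S i j) (C k).
  move=> ik jk; have [_ _ fpi] := DC i; have [_ _ fpj] := DC j.
  have [_ _ fpk] := DC k.
  apply: (fp_over_quotient sD) => // [x Dx|x|].
  - exists x, 0; rewrite addr0; split=> //; first by apply: (Cle 0%N).
    by exists 0; rewrite ?linear0 //; apply: submodule0.
  - exact: SC.
  apply: fg_over_sum => //; try exact: submodule0.
  - by exists 0; rewrite ?linear0 //; apply: submodule0.
  - exact: fp_over_fg.
  - by apply: fg_over_image => //; apply: fp_over_fg.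
have step k s0 : homotopy_on (S k k) s0 ->
    exists s1, homotopy_on (S k.+1 k.+1) s1 /\ forall x, S k k x -> s1 x = s0 x.
  move=> hs0.
  have [s1 [hs1 s1E]] := homotopy_extend (sS k k) (sS k k.+1) (sC k.+2)
    (fun x => Sle k k k k.+1 x (leqnn k) (leqnSn k))
    (fun x => SC k k.+1 k.+2 x (ltnW (leqnSn k.+1)) (leqnn k.+2))
    (fun x Sx => phiS k k.+1 k x Sx)
    (fpS k k k.+2 (ltnW (leqnSn k.+1)) (ltnW (leqnn k.+2)))
    (fpS k k.+1 k.+2 (ltnW (leqnSn k.+1)) (leqnn k.+2)) hs0.
  have [s2 [hs2 s2E]] := homotopy_extend (sS k k.+1) (sS k.+1 k.+1) (sC k.+2)
    (fun x => Sle k k.+1 k.+1 k.+1 x (leqnSn k) (leqnn k.+1))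
    (fun x => SC k.+1 k.+1 k.+2 x (leqnSn k.+1) (leqnn k.+2))
    (fun x Sx => phiS k.+1 k.+1 k x Sx)
    (fpS k k.+1 k.+2 (ltnW (leqnSn k.+1)) (leqnn k.+2))
    (fpS k.+1 k.+1 k.+2 (leqnSn k.+1) (leqnn k.+2)) hs1.
  by exists s2; split=> // x Sx; rewrite s2E ?s1E //; apply: Sle Sx.
(* The homotopy condition is kept inside the chosen statement, with [s0] itself as default, so that
   [nexts] is total and the recursion [sk] carries no proofs. *)
have /choice [nexts nextsP] : forall ks : nat * (Q -> X), exists s1,
    homotopy_on (S ks.1 ks.1) ks.2 -> homotopy_on (S ks.1.+1 ks.1.+1) s1 /\
      forall x, S ks.1 ks.1 x -> s1 x = ks.2 x.
  move=> [k s0] /=; have [/step [s1 ?]|] := pselect (homotopy_on (S k k) s0).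
    by exists s1.
  by exists s0.
pose sk := fix sk k := if k is j.+1 then nexts (j, sk j) else s.
have S0 x : S 0%N 0%N x <-> D x.
  split=> [[y [_ [Dy [z Dz ->] ->]]]|Dx]; first exact: submoduleD (phiD z Dz).
  by exists x, 0; rewrite addr0; split=> //; exists 0; rewrite ?linear0 //; case: sD.
have hsk k : homotopy_on (S k k) (sk k).
  elim: k => [|k IH]; last by case: (nextsP (k, sk k) IH).
  case: hs => ls hs; split=> [a x y /S0 Dx /S0 Dy|x /S0 Dx]; first exact: ls.
  by case: (hs x Dx) => ? ?; split=> //; apply/S0.
have skS k x : S k k x -> sk k.+1 x = sk k x.
  by have [_ +] := nextsP (k, sk k) (hsk k); apply.
have skle j k x : (j <= k)%N -> S j j x -> sk k x = sk j x.
  move=> /subnK <- Sx; elim: (k - j)%N => // i IH.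
  by rewrite addSn skS ?IH //; apply: Sle Sx; apply: leq_addl.
(* Since phi(C_k) lies in C_(k+1), the union of the C_k is also the union of the [S k k]: the first
   description puts it in [L], the second carries the homotopies. *)
pose D' x := exists k, C k x.
have D'S x : D' x <-> exists k, S k k x.
  split=> [] [k Cx]; last by exists k.+1; apply: SC Cx.
  exists k, x, 0; rewrite addr0; split=> //; exists 0; rewrite ?linear0 //.
  exact: submodule0.
pose s' x := if pselect (exists k, S k k x) is left Sx then sk (sval (cid Sx)) x else 0.
have s'E k x : S k k x -> s' x = sk k x.
  move=> Sx; rewrite /s'; case: pselect => [Sx'|]; last by case; exists k.
  case: cid => j /= Sj; have [jk|kj] := leqP j k; first by rewrite (skle j k).
  by rewrite (skle k j) // ltnW.
exists D', s'; split=> [|||x Dx].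
- have -> : D' = fun x => exists2 E, (exists k, E = C k) & E x.
    apply: funext => x; apply/propext; split=> [[k Ckx]|[_ [k ->] Ckx]].
      by exists (C k) => //; exists k.
    by exists k.
  apply: L_chain => [_ [k ->]||_ _ [j ->] [k ->]]; first by case: (DC k).
    by exists (C 0%N), 0%N.
  have [jk|/ltnW kj] := leqP j k; [left|right] => x; exact: Cle.
- split=> [a x y /D'S [j Sjx] /D'S [k Sky]|x /D'S [k Skx]].
    have jx := Sle _ _ _ _ _ (leq_maxl j k) (leq_maxl j k) Sjx.
    have ky := Sle _ _ _ _ _ (leq_maxr j k) (leq_maxr j k) Sky.
    rewrite !(s'E (maxn j k)) //; last by case: (sS (maxn j k) (maxn j k)) => _; apply.
    by case: (hsk (maxn j k)) => + _; apply.
  have [Sphi hE] := (hsk k).2 x Skx.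
  by split; [apply/D'S; exists k|rewrite !(s'E k)].
- by exists 1%N.
- split; first by exists 0%N.
  by rewrite (s'E 0%N) //; apply/S0.
Qed.

Hypothesis L0 : L (fun x => x = 0).

(** Partial homotopies are ordered as graphs in Q * X, so that the upper bound of a chain is a plain
    union. By [homotopy_enlarge], a maximal one is defined everywhere. *)
Lemma homotopy_exists :
  exists s : {linear Q -> X}, forall x, h x = d (s x) + s (phi x).
Proof.
pose ok (G : set (Q * X)) :=
  [/\ L (fun q => exists x, G (q, x)), forall x, G (0, x) -> x = 0,
      forall a q q' x x', G (q, x) -> G (q', x') -> G (a *: q + q', a *: x + x')
    & forall q x, G (q, x) -> exists2 x', G (phi q, x') & h q = d x + x'].
have [||G [[LG G0 Glin Gh] _ maxG]] := @Zorn_above _ ok (fun p => p = (0, 0)).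
- split=> [|x [->] //|a q q' x x' [-> ->] [-> ->]|q x [-> ->]].
  + by congr L: L0; apply: funext => q; apply/propext; split=> [->|[x []]] //; exists 0.
  + by rewrite !scaler0 !addr0.
  + by exists 0; rewrite !linear0 ?addr0.
- move=> F okF tot [G0 FG0].
  have up G G' p p' : F G -> F G' -> G p -> G' p' ->
      exists G1, [/\ F G1, G1 p & G1 p'].
    move=> FG FG' Gp Gp'.
    case: (tot G G' FG FG') => sub; [exists G'|exists G]; split=> //; exact: sub.
  split=> [|x [G FG Gx]|a q q' x x' [G FG Gq] [G' FG' Gq']|q x [G FG Gq]].
  + pose FD D := exists2 G, F G & D = fun q => exists x, G (q, x).
    have -> : (fun q => exists x, (\bigcup_(G in F) G)%classic (q, x))
        = fun q => exists2 D, FD D & D q.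
      apply: funext => q; apply/propext; split=> [[x [G FG Gq]]|].
        by exists (fun q => exists x, G (q, x)); [exists G|exists x].
      by move=> [_ [G FG ->] [x Gq]]; exists x, G.
    apply: L_chain => [_ [G FG ->]||_ _ [G FG ->] [G' FG' ->]].
    * by case: (okF G FG).
    * by exists (fun q => exists x, G0 (q, x)), G0.
    * by case: (tot G G' FG FG') => sub; [left|right] => q [x Gx]; exists x; apply: sub.
  + by case: (okF G FG) => _ + _ _; apply.
  + have [G1 [FG1 G1q G1q']] := up _ _ _ _ FG FG' Gq Gq'.
    by exists G1 => //; case: (okF G1 FG1) => _ _ + _; apply.
  + case: (okF G FG) => _ _ _ /(_ q x Gq) [x' Gx' ->].
    by exists x' => //; exists G.
set D := (fun q => _) in LG; have sD := L_submodule LG.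
have [s [ls sE]] := graph_function sD (fun q Dq => Dq) Glin G0.
have Gs q : D q -> G (q, s q) by move=> [x Gq]; rewrite (sE q x) //; exists x.
have hs : homotopy_on D s.
  split=> // q Dq; have [x' Gx' ->] := Gh _ _ (Gs q Dq).
  by split; [exists x'|rewrite (sE _ _ _ Gx') //; exists x'].
have Dall q : D q.
  have [D' [s' [LD' hs' D'q DD']]] := homotopy_enlarge q LG hs.
  have sD' := L_submodule LD'; case: hs' => ls' hs'.
  pose G' (p : Q * X) := D' p.1 /\ p.2 = s' p.1.
  have D'E : (fun q => exists x, G' (q, x)) = D'.
    apply: funext => r; apply/propext; split=> [[x []//]|D'r].
    by exists (s' r).
  have okG' : ok G'.
    split=> [|x [_ /= ->]|a r r' x x' [/= D'r ->] [/= D'r' ->]|r x [/= D'r ->]].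
    + by rewrite D'E.
    + exact: linear_on0 ls'.
    + by split=> /=; [case: sD' => _; apply|rewrite ls'].
    + by have [? ?] := hs' r D'r; exists (s' (phi r)).
  have GG' : subset G G'.
    move=> [r x] Gr; have Dr : D r by exists x.
    have [D'r s'E] := DD' r Dr.
    by split=> //=; rewrite s'E; apply/esym/sE.
  by exists (s' q); apply: (maxG G' okG' GG').
have [g gE] := linear_exists (fun a x y => ls a x y (Dall x) (Dall y)).
by exists g => x; rewrite !gE; case: (hs.2 x (Dall x)).
Qed.

End Homotopy.

(** * Modules built from finitely presented cells *)

Section Span.
Variables (R : pzRingType) (V : lmodType R).
Implicit Types (Y Z : V -> Prop).

Definition linear_span Y : V -> Prop :=
  fun x => forall P, submodule P -> (forall y, Y y -> P y) -> P x.

Lemma span_submodule Y : submodule (linear_span Y).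
Proof.
split=> [P [P0 _] _ //|a x x' Yx Yx' P sP YP].
by case: (sP) => _; apply; [apply: Yx|apply: Yx'].
Qed.

Lemma mem_span Y x : Y x -> linear_span Y x.
Proof. by move=> Yx P _; apply. Qed.

Lemma span_min Y (P : V -> Prop) x :
  submodule P -> (forall y, Y y -> P y) -> linear_span Y x -> P x.
Proof. by move=> sP YP; apply. Qed.

Lemma sub_span Y Z x : (forall y, Y y -> linear_span Z y) -> linear_span Y x -> linear_span Z x.
Proof. by move=> YZ; apply; [apply: span_submodule|]. Qed.

End Span.

Section Cells.
Variables (R : pzRingType) (A : lmodType R).

(* [Gen r y B v i] is the i-th of n new generators x subject to the relations
   r x = B y; they are sent to v in A. *)
Inductive gen : Type :=
  Gen (m n l : nat) (r : 'M[R]_(m, n)) (y : 'I_l -> gen) (B : 'M[R]_(m, l))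
      (v : 'I_n -> A) (i : 'I_n).

Record cell := Cell {
  cell_m : nat; cell_n : nat; cell_l : nat;
  cell_rel : 'M[R]_(cell_m, cell_n);
  cell_dep : 'I_cell_l -> gen;
  cell_rhs : 'M[R]_(cell_m, cell_l);
  cell_val : 'I_cell_n -> A }.

Arguments cell_dep : clear implicits.
Arguments cell_val : clear implicits.

Definition gen_of (c : cell) (i : 'I_(cell_n c)) : gen :=
  Gen (cell_rel c) (cell_dep c) (cell_rhs c) (cell_val c) i.

Definition cell_of (g : gen) : cell :=
  let: Gen _ _ _ r y B v _ := g in Cell r y B v.

Definition gen_index (g : gen) : nat :=
  let: Gen _ _ _ _ _ _ _ i := g in i.

Fixpoint gen_height (g : gen) : nat :=
  let: Gen _ _ l _ y _ _ _ := g in (\max_(k < l) gen_height (y k)).+1.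

Definition height (c : cell) : nat :=
  (\max_(k < cell_l c) gen_height (cell_dep c k)).+1.

Lemma gen_ofK c i : cell_of (@gen_of c i) = c.
Proof. by case: c i. Qed.

Lemma gen_ofP g : exists i, g = @gen_of (cell_of g) i.
Proof. by case: g => m n l r y B v i; exists i. Qed.

Lemma gen_of_inj c : injective (@gen_of c).
Proof. by move=> i j /(congr1 gen_index) /= ij; apply: val_inj. Qed.

Lemma height_dep (c : cell) (k : 'I_(cell_l c)) : (height (cell_of (cell_dep c k)) < height c)%N.
Proof.
rewrite /height ltnS; apply: leq_trans (leq_bigmax k) => /=.
by case: (cell_dep c k).
Qed.

Definition dep_closed (S : cell -> Prop) : Prop :=
  forall c k, S c -> S (cell_of (cell_dep c k)).

Definition below (k : nat) : cell -> Prop := fun c => (height c < k)%N.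

Lemma closed_below k : dep_closed (below k).
Proof. by move=> c i; apply: ltn_trans; apply: height_dep. Qed.

Variables (F : lmodType R) (b : gen -> F) (p : {linear F -> A}).
Hypothesis b_word : forall x, exists w, x = eval_word b w.
Hypothesis b_univ : forall (V : lmodType R) (v : gen -> V),
  exists f : {linear F -> V}, forall t, f (b t) = v t.
Hypothesis p_gen : forall c i, p (b (@gen_of c i)) = cell_val c i.

Definition head c (a : 'rV[R]_(cell_n c)) : F := comb a (fun i => b (gen_of i)).
Definition tail c (a : 'rV[R]_(cell_m c)) : F :=
  comb (a *m cell_rhs c) (fun k => b (cell_dep c k)).
Definition relator c (a : 'rV[R]_(cell_m c)) : F :=
  head (a *m cell_rel c) - tail a.

Lemma head_linear c : linear (@head c).
Proof. exact: comb_linear. Qed.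

Lemma tail_linear c : linear (@tail c).
Proof.
move=> a x y; rewrite /tail mulmxDl -scalemxAl; exact: comb_linear.
Qed.

Lemma relator_linear c : linear (@relator c).
Proof.
move=> a x y; rewrite /relator mulmxDl -scalemxAl head_linear tail_linear.
by rewrite scalerBr opprD addrACA.
Qed.

Lemma relator0 c : @relator c 0 = 0.
Proof. by rewrite /relator /head /tail !mul0mx !comb0 subrr. Qed.

Definition gens (S : cell -> Prop) : F -> Prop :=
  linear_span (fun x => exists c i, S c /\ x = b (@gen_of c i)).

Lemma gens_submodule S : submodule (gens S).
Proof. exact: span_submodule. Qed.

Lemma gens_head (S : cell -> Prop) c a : S c -> gens S (@head c a).
Proof.
move=> Sc; apply: comb_submodule; first exact: gens_submodule.
by move=> i; apply: mem_span; exists c, i.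
Qed.

Lemma gens_tail (S : cell -> Prop) c a :
  (forall k, S (cell_of (cell_dep c k))) -> gens S (@tail c a).
Proof.
move=> Sc; apply: comb_submodule; first exact: gens_submodule.
move=> k; apply: mem_span; have [i iE] := gen_ofP (cell_dep c k).
by exists (cell_of (cell_dep c k)), i; split=> //; rewrite -iE.
Qed.

Lemma sub_gens (S S' : cell -> Prop) x :
  (forall c, S c -> S' c) -> gens S x -> gens S' x.
Proof.
move=> SS'; apply: sub_span => _ [c [i [Sc ->]]].
by apply: mem_span; exists c, i; split=> //; apply: SS'.
Qed.

(** F is free on the generators, so the coordinates at the generators of [c] are well defined. They
    serve to isolate the contribution of one cell in an equation. *)
Lemma coefficient_exists c : exists kappa : {linear F -> 'rV[R]_(cell_n c)},
  (forall a, kappa (@head c a) = a) /\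
  forall (S : cell -> Prop) x, ~ S c -> gens S x -> kappa x = 0.
Proof.
pose v g : 'rV[R]_(cell_n c) :=
  if pselect (exists i, g = @gen_of c i) is left E then delta_mx 0 (sval (cid E))
  else 0.
have [kappa kE] := b_univ v; exists kappa; split=> [a|S x Sc].
  rewrite /head linear_comb -[RHS]comb_basis; apply: eq_comb => i /=.
  rewrite kE /v; case: pselect => [E|]; last by case; exists i.
  by case: cid => j /= /gen_of_inj ->.
apply: (span_min (kernel_submodule kappa)).
move=> _ [c' [i [Sc' ->]]]; rewrite kE /v; case: pselect => // E; case: Sc.
by have [j /(congr1 cell_of)] := E; rewrite !gen_ofK => <-.
Qed.

(** Since [p] sends [head (a *m cell_rel c)] to the right-hand side, this says that [p] kills the
    relators of [c]. *)
Definition val_compatible c : Prop :=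
  forall a, p (@tail c a) = comb (a *m cell_rel c) (cell_val c).

(* Relations are imposed only for cells whose right-hand sides satisfy all
   syzygies of the matrix modulo the relations of lower height, so that
   attaching a cell does not collapse anything. *)
Fixpoint relations_below k : F -> Prop :=
  if k is j.+1 then
    linear_span (fun x => relations_below j x \/
      exists c a, [/\ height c = j, val_compatible c,
        forall a', a' *m cell_rel c = 0 -> relations_below j (tail a')
        & x = @relator c a])
  else fun x => x = 0.

(** A cell that fails this condition keeps its generators in F but imposes no relations, so they
    remain free. *)
Definition attached c : Prop :=
  val_compatible c /\
  forall a, a *m cell_rel c = 0 -> relations_below (height c) (@tail c a).

Definition relations (S : cell -> Prop) : F -> Prop :=
  linear_span (fun x => exists c a, [/\ S c, attached c & x = @relator c a]).

Lemma relations_submodule S : submodule (relations S).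
Proof. exact: span_submodule. Qed.

Lemma sub_relations (S S' : cell -> Prop) x :
  (forall c, S c -> S' c) -> relations S x -> relations S' x.
Proof.
move=> SS'; apply: sub_span => _ [c [a [Sc cc ->]]].
by apply: mem_span; exists c, a; split=> //; apply: SS'.
Qed.

Lemma relations_belowP k x : relations_below k x <-> relations (below k) x.
Proof.
split.
  elim: k x => [_ ->|k IH x /=]; first exact: submodule0 (relations_submodule _).
  apply: sub_span => y [/IH|[c [a [cj cv cr ->]]]].
    by apply: sub_relations => c; rewrite /below => /leqW.
  apply: mem_span; exists c, a; split=> //; first by rewrite /below cj.
  by split=> //; rewrite cj.
have sk j : submodule (relations_below j).
  case: j => [|j]; last exact: span_submodule.
  by split=> [|a _ _ -> ->] //; rewrite scaler0 addr0.
have up j i y : (i <= j)%N -> relations_below i y -> relations_below j y.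
  move=> /subnK <- iy; elim: (j - i)%N => // n IH.
  by rewrite addSn; apply: mem_span; left.
apply: (span_min (sk k)) => _ [c [a [ck [cv cr] ->]]]; apply: up ck _ => /=.
by apply: mem_span; right; exists c, a.
Qed.

Lemma relations_gens S x : dep_closed S -> relations S x -> gens S x.
Proof.
move=> cS; apply: (span_min (gens_submodule S)) => _ [c [a [Sc _ ->]]].
apply: (submoduleB (gens_submodule S)); first exact: gens_head.
by apply: gens_tail => k; apply: cS.
Qed.

Definition add_cell (S : cell -> Prop) c : cell -> Prop := fun c' => c' = c \/ S c'.

Lemma closed_add (S : cell -> Prop) c : dep_closed S ->
  (forall k, S (cell_of (cell_dep c k))) -> dep_closed (add_cell S c).
Proof. by move=> cS Sc c' k [E|Sc']; right; [subst c'|apply: cS]. Qed.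

Lemma relations_add S c x : relations (add_cell S c) x ->
  exists s a, [/\ relations S s, x = s + @relator c a & attached c \/ a = 0].
Proof.
pose P x := exists s a, [/\ relations S s, x = s + @relator c a & attached c \/ a = 0].
have sP : submodule P.
  have [r0 rD] := relations_submodule S.
  split; first by exists 0, 0; rewrite relator0 addr0; split=> //; right.
  move=> k _ _ [s [a [Ss -> ca]]] [s' [a' [Ss' -> ca']]].
  exists (k *: s + s'), (k *: a + a'); split; first exact: rD.
    by rewrite relator_linear scalerDr addrACA.
  case: ca ca' => [?|->] [?|->]; try by left.
  by right; rewrite scaler0 addr0.
apply: (span_min sP) => _ [c' [a [[cc|Sc'] cc' ->]]].
  subst c'; exists 0, a; rewrite add0r; split=> //; last by left.
  exact: submodule0 (relations_submodule S).
exists (relator a), 0; rewrite relator0 addr0; split=> //; last by right.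
by apply: mem_span; exists c', a.
Qed.

Lemma relations_add_coef S c x y s a a' : dep_closed S -> ~ S c ->
  (forall k, S (cell_of (cell_dep c k))) ->
  gens S y -> relations S s -> x = head a' + y -> x = s + @relator c a ->
  a' = a *m cell_rel c.
Proof.
move=> cS Sc Sdep Sy Ss -> E; have [kappa [kh k0]] := coefficient_exists c.
have := congr1 kappa E; rewrite /relator !linearD !linearN !kh.
rewrite (k0 S y) // (k0 S s) //; last exact: relations_gens.
by rewrite (k0 S (tail a)) ?subr0 ?addr0 ?add0r //; apply: gens_tail.
Qed.

(** An element of [gens S] has zero coefficient at [c], so the relator of [c] that occurs has a r =
    0 and reduces to minus its tail. For an attached cell this tail is already a relation of lower
    height, hence one of S. *)
Lemma relations_add_conservative S c x : dep_closed S -> ~ S c ->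
  (forall c', below (height c) c' -> S c') ->
  gens S x -> relations (add_cell S c) x -> relations S x.
Proof.
move=> cS Sc lowS Sx /relations_add [s [a [Ss xE ca]]].
have Sdep k : S (cell_of (cell_dep c k)) by apply: lowS; apply: height_dep.
have a0 : 0 = a *m cell_rel c.
  by apply: (relations_add_coef cS Sc Sdep Sx Ss _ xE); rewrite /head comb0 add0r.
rewrite xE; apply: (submoduleD (relations_submodule S)) => //.
case: ca => [[_ cr]|->]; last first.
  by rewrite relator0; apply: submodule0 (relations_submodule S).
rewrite /relator -a0 /head comb0 sub0r; apply: (submoduleN (relations_submodule S)).
by apply: (sub_relations lowS); apply/relations_belowP; apply: cr.
Qed.

(** A given relation involves finitely many cells. Those of height [k] can be removed one at a time,
    all their dependencies lying in [below k], and then [k] decreases. *)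
Lemma relations_conservative_below k S x : dep_closed S -> gens S x ->
  relations (fun c => S c \/ below k c) x -> relations S x.
Proof.
move=> cS Sx; elim: k => [|k IH]; first by apply: sub_relations => c [].
pose S0 c := S c \/ below k c.
pose adds := foldr (fun c S' => add_cell S' c) S0.
move=> h; apply: IH; move: h.
have adds_cat cs cs' c : adds cs c \/ adds cs' c -> adds (cs ++ cs') c.
  elim: cs => [|d cs IH] /=.
    by case=> // S0c; elim: cs' => //= d cs' IH; right.
  by case=> [[->|?]|?]; [left|right; apply: IH; left|right; apply: IH; right].
pose low cs := foldr (fun c P => (height c <= k)%N /\ P) True cs.
have low_cat cs cs' : low cs -> low cs' -> low (cs ++ cs').
  by elim: cs => //= d cs IH [? /IH h] /h.
pose P x := exists2 cs, low cs & relations (adds cs) x.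
have sP : submodule P.
  split; first by exists [::] => //; apply: submodule0 (relations_submodule _).
  move=> a y y' [cs lcs ry] [cs' lcs' ry']; exists (cs ++ cs'); first exact: low_cat.
  case: (relations_submodule (adds (cs ++ cs'))) => _; apply.
    by apply: sub_relations ry => c ?; apply: adds_cat; left.
  by apply: sub_relations ry' => c ?; apply: adds_cat; right.
have closed_adds cs : low cs -> dep_closed (adds cs).
  elim: cs => [_ c i [Sc|kc]|c cs IH [ck lcs]] /=.
  - by left; apply: cS.
  - by right; apply: closed_below.
  apply: closed_add; first exact: IH.
  move=> i; have : below k (cell_of (cell_dep c i)).
    rewrite /below; exact: leq_trans (height_dep i) ck.
  by elim: cs {IH lcs} => [|d cs IH] kc /=; right => //; apply: IH.
have adds_below cs c : S0 c -> adds cs c.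
  by elim: cs => //= d cs IH S0c; right; apply: IH.
case/(span_min sP) => [_ [c [a [Sc ca ->]]]|cs].
  case: Sc => [Sc|ck].
    by exists [::] => //; apply: mem_span; exists c, a; split=> //; left.
  by exists [:: c] => //; apply: mem_span; exists c, a; split=> //; left.
elim: cs => // c cs IH [ck lcs] /= rx; apply: IH => //.
have [cs_c|cs_c] := pselect (adds cs c).
  by apply: sub_relations rx => c' [->|].
apply: relations_add_conservative rx => //.
- exact: closed_adds.
- by move=> c' c'c; apply: adds_below; right; apply: leq_trans ck.
- by apply: sub_gens Sx => c' Sc'; apply: adds_below; left.
Qed.

(** Thus the submodule of Q spanned by a closed set of cells is presented by the relations of these
    cells alone. *)
Lemma relations_conservative S S' x : dep_closed S -> gens S x ->
  relations S' x -> relations S x.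
Proof.
move=> cS Sx S'x.
suff [k kx] : exists k, relations (fun c => S c \/ below k c) x.
  exact: relations_conservative_below kx.
pose P y := exists k, relations (fun c => S c \/ below k c) y.
have sP : submodule P; last first.
  move: S'x; apply: (span_min sP) => _ [c [a [_ ca ->]]].
  by exists (height c).+1; apply: mem_span; exists c, a; split=> //; right; apply: ltnSn.
split; first by exists 0%N; apply: submodule0 (relations_submodule _).
move=> a y y' [k ky] [k' ky']; exists (maxn k k').
case: (relations_submodule (fun c => S c \/ below (maxn k k') c)) => _; apply.
  apply: sub_relations ky => c [|ck]; [by left|right].
  by apply: leq_trans ck _; apply: leq_maxl.
apply: sub_relations ky' => c [|ck]; [by left|right].
by apply: leq_trans ck _; apply: leq_maxr.
Qed.

(** * The cellular module, its cellular submodules, and the kernel of its map to A *)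

Variables (Q : lmodType R) (q : {linear F -> Q}) (pQ : {linear Q -> A}).
Hypothesis q_surj : surjective_map q.
Hypothesis q_ker : forall x, q x = 0 <-> relations (fun=> True) x.
Hypothesis pQ_q : forall x, pQ (q x) = p x.

Definition cellular (S : cell -> Prop) : Q -> Prop :=
  fun y => exists2 x, gens S x & y = q x.

Lemma cellular_submodule S : submodule (cellular S).
Proof. by apply: image_submodule; apply: gens_submodule. Qed.

Lemma sub_cellular (S S' : cell -> Prop) x :
  (forall c, S c -> S' c) -> cellular S x -> cellular S' x.
Proof. by move=> SS' [y Sy ->]; exists y => //; apply: sub_gens Sy. Qed.

Lemma relator_attached c a : attached c -> q (@relator c a) = 0.
Proof. by move=> cc; apply/q_ker; apply: mem_span; exists c, a. Qed.

Lemma cellular_add S c : dep_closed S -> ~ S c ->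
  (forall k, S (cell_of (cell_dep c k))) ->
  fp_over (cellular S) (cellular (add_cell S c)).
Proof.
move=> cS Sc Sdep; have cS' := closed_add cS Sdep.
(* The relation matrix of the new factor is that of the cell when it is attached, and the matrix
   with no rows otherwise, in which case the factor is free. *)
have [m [r [rE rP]]] : exists m (r : 'M[R]_(m, cell_n c)),
    (forall a : 'rV[R]_m, cellular S (q (head (a *m r)))) /\
    (forall a, attached c \/ a = 0 -> exists a' : 'rV[R]_m, a *m cell_rel c = a' *m r).
  have [cc|cc] := pselect (attached c).
    exists (cell_m c), (cell_rel c); split=> [a|a _]; last by exists a.
    exists (tail a); first exact: gens_tail.
    by apply/eqP; rewrite -subr_eq0 -linearB relator_attached.
  exists 0%N, 0; split=> [a|a [//|->]]; last by exists 0; rewrite !mul0mx.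
  rewrite mulmx0 /head comb0 linear0.
  exact: submodule0 (cellular_submodule S).
have qhead a : q (head a) = comb a (fun i => q (b (@gen_of c i))).
  exact: linear_comb.
exists (cell_n c), (fun i => q (b (gen_of i))), m, r; split=> [i|_ [x Sx ->]|a].
- exists (b (gen_of i)) => //; apply: mem_span.
  by exists c, i; split=> //; left.
- pose P x := exists a y, cellular S y /\ q x = q (@head c a) + y.
  have [a [y [Sy xE]]] : P x; last by exists a, y; rewrite -qhead.
  have sP : submodule P.
    have [C0 CD] := cellular_submodule S.
    split; first by exists 0, 0; rewrite addr0 /head comb0 linear0.
    move=> k u u' [a [y [Sy uE]]] [a' [y' [Sy' u'E]]].
    exists (k *: a + a'), (k *: y + y'); split; first exact: CD.
    by rewrite linearP uE u'E head_linear linearP scalerDr addrACA.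
  move: Sx; apply: (span_min sP) => _ [c' [i [[cc|Sc'] ->]]].
    subst c'; exists (delta_mx 0 i), 0; rewrite addr0 /head comb_delta.
    by split=> //; apply: submodule0 (cellular_submodule S).
  exists 0, (q (b (gen_of i))); rewrite /head comb0 linear0 add0r; split=> //.
  by exists (b (gen_of i)) => //; apply: mem_span; exists c', i.
rewrite -qhead; split=> [[y Sy aE]|[a' ->]]; last exact: rE.
have Rz : relations (fun=> True) (head a - y).
  by apply/q_ker; rewrite linearB aE subrr.
have Sz : gens (add_cell S c) (head a - y).
  apply: (submoduleB (gens_submodule _)); first by apply: gens_head; left.
  by apply: sub_gens Sy => c'; right.
have [s [a' [Ss zE /rP [b' b'E]]]] :=
  relations_add (relations_conservative cS' Sz Rz).
exists b'; rewrite -b'E.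
apply: (relations_add_coef cS Sc Sdep _ Ss erefl zE).
exact: submoduleN (gens_submodule S) Sy.
Qed.

Definition fp_step (S S' : cell -> Prop) : Prop :=
  [/\ dep_closed S', forall c, S c -> S' c & fp_over (cellular S) (cellular S')].

Lemma fp_step_refl S : dep_closed S -> fp_step S S.
Proof.
move=> cS; split=> //; apply: fp_over_refl.
exact: submodule0 (cellular_submodule S).
Qed.

Lemma fp_step_trans S S' S'' : fp_step S S' -> fp_step S' S'' -> fp_step S S''.
Proof.
move=> [cS' SS' fp] [cS'' SS'' fp']; split=> // [c /SS'/SS'' //|].
apply: (fp_over_trans (cellular_submodule S) (cellular_submodule S')
  (cellular_submodule S'') _ _ fp fp') => x; exact: sub_cellular.
Qed.

Lemma fp_step_seq (I : eqType) (t : seq I) (f : I -> cell) S : dep_closed S ->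
  (forall S i, dep_closed S -> i \in t -> exists2 S', fp_step S S' & S' (f i)) ->
  exists2 S', fp_step S S' & forall i, i \in t -> S' (f i).
Proof.
move=> cS; elim: t => [_|i t IH step]; first by exists S => //; apply: fp_step_refl.
have [|S1 SS1 S1t] := IH.
  by move=> S' j cS' jt; apply: step; rewrite // inE jt orbT.
have [cS1 _ _] := SS1.
have [|S2 S12 S2i] := step S1 i cS1; first by rewrite inE eqxx.
exists S2 => [|j]; first exact: fp_step_trans S12.
rewrite inE => /orP [/eqP -> //|/S1t]; by case: S12 => _ + _; apply.
Qed.

(** Induction on the height: the finitely many dependencies are adjoined first, and then the cell
    itself. *)
Lemma fp_step_cell S c : dep_closed S -> exists2 S', fp_step S S' & S' c.
Proof.
have [k] := ubnP (height c); elim: k c S => // k IH c S ck cS.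
have [|S1 SS1 S1dep] :=
    @fp_step_seq _ (enum 'I_(cell_l c)) (fun i => cell_of (cell_dep c i)) S cS.
  move=> S' i cS' _; apply: IH => //.
  by apply: leq_trans (height_dep i) _; rewrite -ltnS.
have [S1c|S1c] := pselect (S1 c); first by exists S1.
have [cS1 _ _] := SS1.
have dep i : S1 (cell_of (cell_dep c i)) by apply: S1dep; rewrite mem_enum.
exists (add_cell S1 c); last by left.
apply: fp_step_trans SS1 _; split; first exact: closed_add.
  by move=> c'; right.
exact: cellular_add.
Qed.

Lemma fp_step_elt S x : dep_closed S -> exists2 S', fp_step S S' & cellular S' x.
Proof.
move=> cS; have [y <-] := q_surj x; have [w ->] := b_word y.
have [|S' SS' S'w] := @fp_step_seq _ (enum 'I_(size w))
    (fun i => cell_of (tnth (in_tuple w) i).2) S cS.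
  by move=> S' i cS' _; apply: fp_step_cell.
exists S' => //; exists (eval_word b w) => //; rewrite /eval_word big_tnth.
apply: (submodule_sum _ (gens_submodule S')) => i.
apply: (submoduleZ _ (gens_submodule S')); apply: mem_span.
have [j jE] := gen_ofP (tnth (in_tuple w) i).2.
exists (cell_of (tnth (in_tuple w) i).2), j; split; last by rewrite -jE.
by apply: S'w; rewrite mem_enum.
Qed.

Lemma words_common (t : seq F) : exists l (y : 'I_l -> gen),
  forall j, (j < size t)%N -> exists c : 'rV[R]_l, nth 0 t j = comb c (b \o y).
Proof.
elim: t => [|x t [l [y yE]]].
  have y0 : 'I_0 -> gen by case.
  by exists 0%N, y0.
have [w ->] := b_word x.
exists (size w + l)%N, (fun i => match fintype.split i with
  inl j => (tnth (in_tuple w) j).2 | inr k => y k end).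
have E (c : 'rV[R]_(size w)) (c' : 'rV[R]_l) : comb (row_mx c c')
    (b \o (fun i => match fintype.split i with
      inl j => (tnth (in_tuple w) j).2 | inr k => y k end))
    = comb c (fun j => b (tnth (in_tuple w) j).2) + comb c' (b \o y).
  rewrite -comb_row_mx; apply: eq_comb => i /=.
  by case: fintype.split.
case=> [_|j /yE [c cE]] /=; last first.
  by exists (row_mx 0 c); rewrite E comb0 add0r.
exists (row_mx (\row_j (tnth (in_tuple w) j).1) 0); rewrite E comb0 addr0.
rewrite /eval_word big_tnth /comb; apply: eq_bigr => i _.
by rewrite mxE.
Qed.

(** Write lifts of the right-hand sides as B y with finitely many common generators [y]; then r, y,
    B with value 0 form a cell, and its generators solve the system inside the kernel. The cell is
    attached: its tails map to 0 in A because [t] lies in the kernel, and when a r = 0 its tail is a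
    relation which, by conservativity, already follows from cells of lower height. *)
Lemma cellular_ker_solvable : solvable_on (fun x => pQ x = 0).
Proof.
move=> m n r t pt rel.
have /choice [u uE] : forall j, exists x, q x = t j by move=> j; apply: q_surj.
have [l [y yE]] := words_common [seq u j | j <- enum 'I_m].
have /choice [B BE] : forall j, exists c : 'rV[R]_l, u j = comb c (b \o y).
  move=> j; have [|c cE] := yE j; first by rewrite size_map size_enum_ord.
  exists c; rewrite -cE (nth_map j) ?size_enum_ord //.
  by rewrite nth_ord_enum.
pose c := Cell r y (\matrix_j B j) (fun=> 0).
have tailE a : q (@tail c a) = comb a t.
  rewrite /tail comb_mul linear_comb; apply: eq_comb => j /=.
  by rewrite -uE BE rowK.
have cc : attached c.
  split=> [a|a ar]; first rewrite -pQ_q tailE linear_comb.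
    by rewrite /comb !big1 // => i _; rewrite /= ?pt scaler0.
  have Ra : relations (fun=> True) (@tail c a) by apply/q_ker; rewrite tailE rel.
  apply/relations_belowP; apply: (relations_conservative _ _ Ra).
    exact: closed_below.
  by apply: gens_tail => k; apply: height_dep.
exists (fun i => q (b (@gen_of c i))); split=> [i|a]; first by rewrite pQ_q p_gen.
rewrite -tailE; have -> : comb (a *m r) (fun i => q (b (@gen_of c i)))
    = q (head (a *m cell_rel c)) by rewrite /head linear_comb.
apply/eqP; by rewrite -subr_eq0 -linearB; apply/eqP; apply: relator_attached.
Qed.

End Cells.

(** * Fp-projective modules as summands of cellular ones *)

Section FpProjective.
Variable R : pzRingType.

Lemma fp_cellular_cover (A : lmodType R) :
  exists (Q : lmodType R) (p : {linear Q -> A}) (L : (Q -> Prop) -> Prop),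
  [/\ surjective_map p, solvable_on (fun x => p x = 0),
      forall D, L D -> submodule D,
      L (fun x => x = 0)
    & (forall F : (Q -> Prop) -> Prop,
        (forall D, F D -> L D) -> (exists D, F D) ->
        (forall D E, F D -> F E ->
           (forall x, D x -> E x) \/ (forall x, E x -> D x)) ->
        L (fun x => exists2 D, F D & D x)) /\
      (forall D x, L D ->
        exists E, [/\ L E, E x, forall x, D x -> E x & fp_over D E])].
Proof.
have [F [b [bw bu]]] := free_exists R (gen A).
have [p pE] := bu A (fun g => let: Gen _ _ _ _ _ _ v i := g in v i).
have pgen (c : cell A) i : p (b (@gen_of _ _ c i)) = cell_val i by rewrite pE.
have [Q [q [qs qker]]] := quotient_exists (relations_submodule b p (fun=> True)).
have pq x : q x = 0 -> p x = 0.
  move/qker; apply: (span_min (kernel_submodule p)) => _ [c [a [_ [cv _] ->]]].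
  rewrite /relator linearB cv /head linear_comb; apply/eqP; rewrite subr_eq0.
  by apply/eqP/eq_comb => i /=; rewrite pgen.
have [pQ pQE] := linear_factor qs pq.
pose L D := exists2 S, dep_closed S & D = cellular b q S.
exists Q, pQ, L; split.
(* Surjectivity comes from cells with one generator of value [a], no relations and no
   dependencies. *)
- move=> a; have y0 : 'I_0 -> gen A by case.
  pose c := Cell (0 : 'M[R]_(0, 1)) y0 0 (fun=> a).
  by exists (q (b (@gen_of _ _ c ord0))); rewrite pQE pgen.
- exact: (@cellular_ker_solvable _ _ _ _ _ bw bu pgen _ _ _ qs qker pQE).
- by move=> _ [S _ ->]; apply: cellular_submodule.
- exists (fun=> False) => //; apply: funext => x; apply/propext; split=> [->|[y S0 ->]].
    exact: submodule0 (cellular_submodule _ _ _).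
  move: S0; have s0 : submodule (fun y => q y = 0) by apply: kernel_submodule.
  by apply: (span_min s0) => z [c [i []]].
split=> [FF FL [D0 FD0] chain|_ x [S cS ->]].
(* Different closed sets may span the same submodule, so all those whose span lies in [FF] are
   united rather than one chosen for each member. *)
- pose S c := exists S, [/\ dep_closed S, FF (cellular b q S) & S c].
  exists S => [c k [S' [cS' FS' S'c]]|]; first by exists S'; split=> //; apply: cS'.
  apply: funext => x; apply/propext; split=> [[D FD Dx]|[y Sy ->]].
    have [S' cS' DE] := FL _ FD; move: FD Dx; rewrite DE => FS'.
    by apply: sub_cellular => c S'c; exists S'.
  pose P y := exists2 D, FF D & D (q y).
  have sP : submodule P.
    split=> [|a y1 y2 [D1 FD1 D1y] [D2 FD2 D2y]].
      exists D0 => //; rewrite linear0; have [S' _ ->] := FL _ FD0.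
      exact: submodule0 (cellular_submodule _ _ _).
    have sub D : FF D -> submodule D.
      by move=> /FL [S' _ ->]; apply: cellular_submodule.
    have [D12|D21] := chain _ _ FD1 FD2.
      by exists D2 => //; rewrite linearP; case: (sub _ FD2) => _; apply; first exact: D12.
    by exists D1 => //; rewrite linearP; case: (sub _ FD1) => _; apply; last exact: D21.
  move: Sy; apply: (span_min sP) => _ [c [i [[S' [cS' FS' S'c]] ->]]].
  exists (cellular b q S') => //; exists (b (gen_of i)) => //.
  by apply: mem_span; exists c, i.
have [S' [cS' SS' fp] S'x] := fp_step_elt bw bu qs qker x cS.
exists (cellular b q S'); split=> //; first by exists S'.
by move=> y; apply: sub_cellular.
Qed.

(** The kernel K is fp-injective, so the identity of K extends to a retraction [v] of Q onto K; then
    x - i (v x) depends only on [p x]. *)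
Lemma fp_projective_section (Q A : lmodType R) (p : {linear Q -> A}) :
  fp_projective A -> surjective_map p -> solvable_on (fun x => p x = 0) ->
  exists sigma : {linear A -> Q}, forall a, p (sigma a) = a.
Proof.
move=> fpA ps sol; have [K [i [iinj iE]]] := submodule_exists (kernel_submodule p).
have solK : solvable K.
  move=> m n r t _ rel.
  have it c : comb c (i \o t) = i (comb c t) by rewrite linear_comb.
  have [||z [pz zE]] := sol m n r (i \o t).
  - by move=> j; apply/iE; exists (t j).
  - by move=> c cr; rewrite it rel ?linear0.
  have /choice [y yE] : forall k, exists y, i y = z k by move=> k; apply/iE.
  exists y; split=> // c; apply: iinj; rewrite -it -zE linear_comb.
  exact: eq_comb.
have ex : short_exact i p by split=> // x; split=> /iE.
have [v vE] :=
  Ext1_extends (fpA _ (solvable_fp_injective solK)) ex idfun.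
have [|||s sE] := @graph_linear R A Q (fun a y => exists2 x, p x = a & y = x - i (v x)).
- by move=> a; have [x xE] := ps a; exists (x - i (v x)), x.
- move=> k a a' y y' [x <- ->] [x' <- ->]; exists (k *: x + x'); rewrite !linearP //=.
  by rewrite scalerDr addrACA.
- by move=> y [x /iE [u <-] ->]; rewrite vE subrr.
exists s => a; have [x xa] := ps a; rewrite (sE a (x - i (v x))); last by exists x.
by rewrite linearB xa (iE _).2 ?subr0 //; exists (v x).
Qed.

Lemma fp_projective_homotopy (A X : lmodType R) (phi : {linear A -> A})
    (d : {linear X -> X}) (h : {linear A -> X}) :
  fp_projective A -> (forall x, phi (phi x) = 0) ->
  (forall x, d x = 0 <-> exists y, d y = x) ->
  solvable_on (fun x => d x = 0) -> (forall x, h (phi x) = d (h x)) ->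
  exists s : {linear A -> X}, forall x, h x = d (s x) + s (phi x).
Proof.
move=> fpA phi2 dex sol hphi.
have [Q [p [L [ps solp Lsub L0 [Lchain Lext]]]]] := fp_cellular_cover A.
have [sg sgE] := fp_projective_section fpA ps solp.
(* Transport along the retraction keeps both phi^2 = 0 and h phi = d h because p sg = 1; composing
   the homotopy on Q with [sg] brings it back to A. *)
pose phiQ : {linear Q -> Q} := (sg \o (phi \o p))%FUN.
pose hQ : {linear Q -> X} := (h \o p)%FUN.
have phiQ2 x : phiQ (phiQ x) = 0 by rewrite /phiQ /= sgE phi2 linear0.
have hphiQ x : hQ (phiQ x) = d (hQ x) by rewrite /hQ /phiQ /= sgE hphi.
have [s sE] := homotopy_exists (phi := phiQ) (h := hQ) phiQ2 dex sol hphiQ Lsub Lchain Lext L0.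
exists (s \o sg)%FUN => x /=.
by have := sE (sg x); rewrite /hQ /phiQ /= !sgE.
Qed.

End FpProjective.

(** * Embedding into an injective module *)

Section Divisible.

Definition divisible (D : zmodType) : Prop :=
  forall (n : nat) (x : D), (0 < n)%N -> exists y, y *+ n = x.

Definition additive_graph (V D : zmodType) (G : V * D -> Prop) : Prop :=
  [/\ G (0, 0),
      forall x x' y y', G (x, y) -> G (x', y') -> G (x - x', y - y')
    & forall y, G (0, y) -> y = 0].

Section AdditiveGraph.
Variables (V D : zmodType) (G : V * D -> Prop).
Hypothesis G_graph : additive_graph G.

Lemma additive_graphN x y : G (x, y) -> G (- x, - y).
Proof.
by have [G0 GB _] := G_graph; move/(GB _ _ _ _ G0); rewrite !sub0r.
Qed.

Lemma additive_graphD x x' y y' :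
  G (x, y) -> G (x', y') -> G (x + x', y + y').
Proof.
have [_ GB _] := G_graph.
by move=> Gx /additive_graphN /(GB _ _ _ _ Gx); rewrite !opprK.
Qed.

Lemma additive_graphMn x y n : G (x, y) -> G (x *+ n, y *+ n).
Proof.
move=> Gx; elim: n => [|n IH]; first by case: G_graph.
by rewrite !mulrS; apply: additive_graphD.
Qed.

Lemma additive_graph_uniq x y y' : G (x, y) -> G (x, y') -> y = y'.
Proof.
have [_ GB Gfun] := G_graph => h h'; apply/eqP; rewrite -subr_eq0; apply/eqP.
by apply: Gfun; have := GB _ _ _ _ h h'; rewrite subrr.
Qed.

(** The multiples of [v] in the domain of G are those of n0 v, with n0 the least positive such
    number; [d] is the value at n0 v divided by n0. If only 0 v lies in the domain, d = 0 works. *)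
Lemma additive_graph_value v : divisible D ->
  exists d, forall n y, G (v *+ n, y) -> y = d *+ n.
Proof.
move=> divD; have [_ GB Gfun] := G_graph.
pose N n := `[< (0 < n)%N /\ exists y, G (v *+ n, y) >].
have [exN|noN] := pselect (exists n, N n); last first.
  exists 0 => -[|n] y Gy; first by rewrite mulr0n; apply: Gfun.
  by case: noN; exists n.+1; apply/asboolP; split=> //; exists y.
case: (ex_minnP exN) => n0 /asboolP [n0_gt0 [y0 Gy0]] min.
have [d dE] := divD n0 y0 n0_gt0; exists d => n y Gy.
have nE := divn_eq n n0; set q := (n %/ n0)%N in nE; set r := (n %% n0)%N in nE.
have Gr : G (v *+ r, y - y0 *+ q).
  have := GB _ _ _ _ Gy (additive_graphMn q Gy0).
  by rewrite nE mulrnDr mulnC mulrnA addrC addKr.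
have r0 : r = 0%N.
  apply/eqP; rewrite -leqn0 leqNgt; apply/negP => r_gt0.
  have : (n0 <= r)%N.
    by apply: min; apply/asboolP; split=> //; exists (y - y0 *+ q).
  by rewrite leqNgt ltn_pmod.
move: Gr; rewrite r0 => /Gfun /eqP; rewrite subr_eq0 => /eqP ->.
by rewrite nE r0 addn0 mulnC mulrnA dE.
Qed.

End AdditiveGraph.

Lemma divisible_extend (V D : zmodType) (G0 : V * D -> Prop) :
  divisible D -> additive_graph G0 ->
  exists f : V -> D, zmod_morphism f /\ forall x y, G0 (x, y) -> f x = y.
Proof.
move=> divD gG0.
have [||G [gG G0G maxG]] := @Zorn_above _ (@additive_graph V D) G0 => //.
  move=> F gF tot [G1 FG1]; split.
  - by exists G1 => //; case: (gF G1 FG1).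
  - move=> x x' y y' [G FG Gx] [G' FG' Gx'].
    by have [sub|sub] := tot G G' FG FG'; [exists G' => //; have [_ + _] := gF G' FG'
      |exists G => //; have [_ + _] := gF G FG]; apply=> //; apply: sub.
  - by move=> y [G FG]; have [_ _ +] := gF G FG; apply.
have [G00 GB Gfun] := gG.
have tot v : exists y, G (v, y).
  have [d dE] := additive_graph_value gG v divD; exists d.
  pose G' (p : V * D) := exists x y (k : int),
    [/\ G (x, y), p.1 = x + v *~ k & p.2 = y + d *~ k].
  have gG' : additive_graph G'.
    split=> [|x x' y y' [x1 [y1 [k [/= Gx -> ->]]]] [x2 [y2 [k' [/= Gx' -> ->]]]]|].
    - by exists 0, 0, 0; rewrite !mulr0z !addr0.
    - exists (x1 - x2), (y1 - y2), (k - k'); split; first exact: GB.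
        by rewrite /= mulrzBr opprD addrACA.
      by rewrite /= mulrzBr opprD addrACA.
    - move=> y [x [z [k [/= Gx /esym/eqP + ->]]]].
      rewrite addr_eq0 => /eqP xE; move: Gx; rewrite {}xE.
      case: k => n; rewrite ?NegzE ?mulrNz ?opprK -!pmulrn => Gx.
        by rewrite -(dE n (- z)) ?addrN //; have := additive_graphN gG Gx; rewrite opprK.
      by rewrite (dE _ _ Gx) subrr.
  apply: (maxG G' gG').
    by move=> [x y] Gx; exists x, y, 0; rewrite !mulr0z !addr0.
  by exists 0, 0, 1; rewrite !mulr1z !add0r.
have /choice [f fG] := tot; exists f; split=> [x x'|x y /G0G Gx].
  exact: (additive_graph_uniq gG (fG _) (GB _ _ _ _ (fG x) (fG x'))).
exact: (additive_graph_uniq gG (fG _) Gx).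
Qed.

(* The witness is Q/Z. *)
Lemma torsion_divisible_exists : exists D : zmodType, divisible D /\
  forall n, n != 1%N -> exists d : D, d != 0 /\ d *+ n = 0.
Proof.
pose N (x : zmodule rat) := exists k : int, x = k%:~R.
have sN : submodule N.
  split; first by exists 0.
  move=> a x y [k ->] [l ->]; exists (a * k + l).
  by rewrite rmorphD rmorphM /= mulrzl.
have [D [q [qs qE]]] := quotient_exists sN.
have divD : divisible D.
  move=> n x n0; have [y <-] := qs x; exists (q (y / n%:R : rat)).
  rewrite -linearMn; congr (q _); rewrite -[_ *+ n](mulr_natr (y / n%:R : rat)).
  by rewrite divfK // Num.Theory.pnatr_eq0 -lt0n.
have tors n : (1 < n)%N -> q (n%:R^-1 : rat) != 0 /\ q (n%:R^-1 : rat) *+ n = 0.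
  move=> n1; have n0 : (n%:R : rat) != 0.
    by rewrite Num.Theory.pnatr_eq0 -lt0n ltnW.
  split.
    apply/eqP => /qE [k kE].
    have : (k * n%:Z)%:~R = 1 :> rat by rewrite rmorphM /= -kE mulVf.
    move/eqP; rewrite -[1]/(1%:~R) eqr_int => /eqP /(congr1 absz).
    by rewrite abszM /= => /eqP; rewrite muln_eq1 => /andP [_ /eqP nE]; rewrite nE in n1.
  rewrite -linearMn; apply/qE; exists 1.
  by rewrite -[LHS](mulr_natr (n%:R^-1 : rat)) mulVf.
exists D; split=> // -[_|[//|n] _]; last by exists (q (n.+2%:R^-1 : rat)); apply: tors.
by exists (q (2%:R^-1 : rat)); rewrite mulr0n; split=> //; case: (tors 2%N).
Qed.

Lemma separating_character (D Z : zmodType) (z : Z) :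
  divisible D -> (forall n, n != 1%N -> exists d : D, d != 0 /\ d *+ n = 0) ->
  z != 0 -> exists chi : Z -> D, zmod_morphism chi /\ chi z != 0.
Proof.
move=> divD tors z0.
(* [n] is the order of [z], with 0 for infinite order; for n = 0 the hypothesis on [D] supplies just
   a nonzero element. *)
have [n [n1 ordz]] : exists n, n != 1%N /\ forall k, z *+ k = 0 -> (n %| k)%N.
  have [exN|noN] := pselect (exists n, (0 < n)%N && (z *+ n == 0)); last first.
    exists 0%N; split=> // -[//|k] zk.
    by case: noN; exists k.+1; rewrite zk eqxx.
  case: (ex_minnP exN) => n /andP [n0 /eqP zn] min; exists n; split.
    by apply: contraNneq z0 => n1; rewrite -zn n1.
  move=> k zk; rewrite /dvdn -leqn0 leqNgt; apply/negP => r0.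
  have : (n <= k %% n)%N.
    apply: min; rewrite r0; apply/eqP; move: zk.
    by rewrite {1}(divn_eq k n) mulrnDr mulnC mulrnA zn mul0rn add0r.
  by rewrite leqNgt ltn_pmod.
have [d [d0 dn]] := tors n n1.
have dk k : z *+ k = 0 -> d *+ k = 0.
  by move=> /ordz /dvdnP [j ->]; rewrite mulnC mulrnA dn mul0rn.
pose G (p : Z * D) := exists k : int, p = (z *~ k, d *~ k).
have [|chi [chiB chiE]] := @divisible_extend Z D G divD.
  split=> [|x x' y y' [k [-> ->]] [k' [-> ->]]|y [k [/esym zk ->]]].
  - by exists 0; rewrite !mulr0z.
  - by exists (k - k'); rewrite !mulrzBr.
  - move: k zk => [k|k]; rewrite ?NegzE ?mulrNz -!pmulrn; first exact: dk.
    by move/eqP; rewrite oppr_eq0 => /eqP /dk ->; rewrite oppr0.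
exists chi; split=> //; rewrite (chiE z d) //.
by exists 1; rewrite !mulr1z.
Qed.

End Divisible.

Lemma zmod_morphism0 (U V : zmodType) (f : U -> V) : zmod_morphism f -> f 0 = 0.
Proof. by move=> /(_ 0 0); rewrite !subrr. Qed.

Lemma zmod_morphismD (U V : zmodType) (f : U -> V) :
  zmod_morphism f -> {morph f : x y / x + y}.
Proof.
move=> fB x y; have fN : f (- y) = - f y.
  by rewrite -sub0r fB zmod_morphism0 ?sub0r.
by rewrite -{1}[y]opprK fB fN opprK.
Qed.

(** I is the coinduced module of additive maps from R to D^K, where K is the set of all characters
    of Z and [a] acts through right multiplication on R. The embedding is z |-> (r |-> chi (r z)),
    injective because characters separate points. *)
Lemma injective_embedding (R : pzRingType) (Z : lmodType R) :
  exists (I : lmodType R) (j : {linear Z -> I}), injective j /\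
    forall (U V : lmodType R) (f : {linear U -> V}), injective f -> extends_to I f.
Proof.
have [D [divD tors]] := torsion_divisible_exists.
pose K := {chi : Z -> D | zmod_morphism chi}.
pose T := {F : K -> R -> D | forall chi, zmod_morphism (F chi)}.
have T_eq (F G : T) : (forall chi r, sval F chi r = sval G chi r) -> F = G.
  case: F G => F HF [G HG] FG; apply: eq_exist.
  by apply: funext => chi; apply: funext => r; apply: FG.
have mk (F : K -> R -> D) (H : forall chi, zmod_morphism (F chi)) :
  exists G : T, sval G = F by exists (exist _ F H).
have /choice [add addE] : forall FG : T * T, exists H : T,
    sval H = fun chi r => sval FG.1 chi r + sval FG.2 chi r.
  move=> [[F HF] [G HG]]; apply: mk => chi r s /=.
  by rewrite HF HG opprD addrACA.
have /choice [opp oppE] : forall F : T, exists H : T,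
    sval H = fun chi r => - sval F chi r.
  by move=> [F HF]; apply: mk => chi r s /=; rewrite HF opprD.
have /choice [scale scaleE] : forall aF : R * T, exists H : T,
    sval H = fun chi r => sval aF.2 chi (r * aF.1).
  by move=> [a [F HF]]; apply: mk => chi r s /=; rewrite mulrBl HF.
have [|zero zeroE] := mk (fun _ _ => 0); first by move=> chi r s; rewrite subrr.
have Fmorph (F : T) chi : zmod_morphism (sval F chi) by case: F.
have [||||||||I [f [g [fK gK fD fZ]]]] := @lmodule_exists R T zero opp
  (fun F G => add (F, G)) (fun a F => scale (a, F)).
- by move=> F G H; apply: T_eq => chi r /=; rewrite !addE /= ?addE addrA.
- by move=> F G; apply: T_eq => chi r /=; rewrite !addE addrC.
- by move=> F; apply: T_eq => chi r /=; rewrite !addE /= zeroE add0r.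
- by move=> F; apply: T_eq => chi r /=; rewrite !addE /= oppE zeroE addNr.
- by move=> a b F; apply: T_eq => chi r /=; rewrite !scaleE /= ?scaleE /= mulrA.
- by move=> F; apply: T_eq => chi r /=; rewrite scaleE mulr1.
- by move=> a F G; apply: T_eq => chi r /=; rewrite scaleE !addE /= ?addE ?scaleE.
- move=> F a b; apply: T_eq => chi r /=; rewrite scaleE addE /= ?scaleE /= mulrDr.
  exact: zmod_morphismD.
have addgE x y chi r : sval (g (x + y)) chi r = sval (g x) chi r + sval (g y) chi r.
  by rewrite -{1}(gK x) -{1}(gK y) -fD fK /= addE.
have scalegE a x chi r : sval (g (a *: x)) chi r = sval (g x) chi (r * a).
  by rewrite -{1}(gK x) -fZ fK /= scaleE.
(* This is the coinduction adjunction: a linear map into I is determined by its values at r = 1, a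
   family of characters of U. Injectivity of I thus reduces to extending characters. *)
have into (U : lmodType R) (e : K -> U -> D) : (forall chi, zmod_morphism (e chi)) ->
    exists v : {linear U -> I}, forall x chi r, sval (g (v x)) chi r = e chi (r *: x).
  move=> eB; have /choice [v vE] : forall x, exists y : T,
      sval y = fun chi r => e chi (r *: x).
    by move=> x; apply: mk => chi r s; rewrite scalerBl eB.
  have [|w wE] := @linear_exists R U I (f \o v).
    move=> a x y /=; rewrite -fZ -fD; congr f; apply: T_eq => chi r.
    by rewrite addE /= scaleE !vE /= scalerDr zmod_morphismD // scalerA.
  by exists w => x chi r; rewrite wE /= fK vE.
have [j jE] := into Z (fun chi => sval chi) (fun chi => svalP chi).
exists I, j; split=> [x y xy|U V i iinj u].
  apply/eqP; rewrite -subr_eq0; apply/negPn/negP => xy0.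
  have [chi [chiB]] := separating_character divD tors xy0.
  have := jE y (exist _ chi chiB) 1; have := jE x (exist _ chi chiB) 1.
  by rewrite xy !scale1r /= chiB => -> ->; rewrite subrr eqxx.
have gB chi : zmod_morphism (fun x => sval (g x) chi 1).
  move=> x y; have := addgE (x - y) y chi 1; rewrite subrK => ->.
  by rewrite addrK.
have /choice [e eP] : forall chi : K, exists e : V -> D, zmod_morphism e /\
    forall x, e (i x) = sval (g (u x)) chi 1.
  move=> chi; pose G (p : V * D) := exists x, p = (i x, sval (g (u x)) chi 1).
  have g0 := zmod_morphism0 (gB chi).
  have [|e [eB eE]] := @divisible_extend V D G divD.
    split=> [|x x' y y' [z [-> ->]] [z' [-> ->]]|y [z [/esym zE ->]]].
    - by exists 0; rewrite !linear0 /= g0.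
    - by exists (z - z'); rewrite !linearB (gB chi).
    - by rewrite (_ : z = 0) ?linear0 //; apply: iinj; rewrite linear0.
  by exists e; split=> // x; apply: eE; exists x.
have [v vE] := into V e (fun chi => (eP chi).1).
exists v => x; apply: (can_inj gK); apply: T_eq => chi r.
by rewrite vE -linearZ (eP chi).2 linearZ scalegE mul1r.
Qed.

(** * Periodic modules *)

Section Periodic.
Variable R : pzRingType.

Lemma submoduleT (V : lmodType R) : submodule (fun _ : V => True).
Proof. by []. Qed.

(** Dimension shifting on cochains of one resolution: a lift [c'] of the cocycle to I has its
    coboundary in J, which is killed in degree k + 2 by some [b]. Then c' - j b vanishes on the
    kernel of the differential, so it factors through the image in P_k and extends to P_k by
    injectivity of I. *)
Lemma strongly_fp_injective_cokernel (J I J' : lmodType R) (j : {linear J -> I})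
    (q : {linear I -> J'}) : short_exact j q ->
  (forall (U V : lmodType R) (f : {linear U -> V}), injective f -> extends_to I f) ->
  strongly_fp_injective J -> strongly_fp_injective J'.
Proof.
move=> [jinj jq qs] injI sJ T [//|k] fpT _ P c cc.
have [c' c'E] := @res_projective R T P k.+1 _ _ q c qs.
have [|||b0 b0E] := @graph_linear R (res_obj P k.+2) J
    (fun x y => j y = c' (res_diff P k.+1 x)).
- by move=> x; apply/jq; rewrite c'E cc.
- by move=> a x x' y y' jy jy'; rewrite !linearP jy jy'.
- by move=> y; rewrite !linear0 -(linear0 j) => /jinj.
have jb0 x : j (b0 x) = c' (res_diff P k.+1 x).
  have [y yE] : exists y, j y = c' (res_diff P k.+1 x).
    by apply/jq; rewrite c'E cc.
  by rewrite (b0E x y yE).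
have [x|b bE] := sJ T k.+2 fpT isT P b0.
  apply: jinj; rewrite jb0 linear0 -(linear0 c'); congr (c' _).
  by apply/res_exact; exists x.
have [U [i [iinj iE]]] := submodule_exists
  (image_submodule (res_diff P k) (submoduleT (res_obj P k.+1))).
have w0 x : res_diff P k x = 0 -> c' x = j (b x).
  by move=> /res_exact [y <-]; rewrite -bE jb0.
have [|||w wE] := @graph_linear R U I
    (fun y z => exists2 x, i y = res_diff P k x & z = c' x - j (b x)).
- move=> y; have [x _ xE] : exists2 x, True & i y = res_diff P k x.
    by apply/iE; exists y.
  by exists (c' x - j (b x)), x.
- move=> a y y' z z' [x xE ->] [x' x'E ->]; exists (a *: x + x').
    by rewrite !linearP xE x'E.
  by rewrite !linearP scalerDr scalerN addrACA -opprD.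
- by move=> z [x + ->]; rewrite linear0 => /esym/w0 ->; rewrite subrr.
have [e eE] := injI _ _ i iinj w.
exists (q \o e)%FUN => x /=.
have [y yE] : exists y, i y = res_diff P k x by apply/iE; exists x.
rewrite -yE eE (wE y (c' x - j (b x))); last by exists x.
by rewrite linearB c'E (jq _).2 ?subr0 //; exists (b x).
Qed.

Lemma strongly_fp_injective_solvable (J : lmodType R) :
  strongly_fp_injective J -> solvable J.
Proof. by move=> sJ; apply: fp_injective_solvable => T fpT; apply: sJ. Qed.

Lemma product_exists (Y : nat -> lmodType R) :
  exists (X : lmodType R) (pr : forall n, {linear X -> Y n}),
    (forall x y, (forall n, pr n x = pr n y) -> x = y) /\
    (forall x : forall n, Y n, exists y, forall n, pr n y = x n).
Proof.
have ext (x y : forall n, Y n) : (forall n, x n = y n) -> x = y.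
  exact: functional_extensionality_dep.
have [||||||||X [f [g [fK gK fD fZ]]]] := @lmodule_exists R (forall n, Y n)
    (fun=> 0) (fun x n => - x n) (fun x y n => x n + y n) (fun a x n => a *: x n).
- by move=> x y z; apply: ext => n; rewrite addrA.
- by move=> x y; apply: ext => n; rewrite addrC.
- by move=> x; apply: ext => n; rewrite add0r.
- by move=> x; apply: ext => n; rewrite addNr.
- by move=> a b x; apply: ext => n; rewrite scalerA.
- by move=> x; apply: ext => n; rewrite scale1r.
- by move=> a x y; apply: ext => n; rewrite scalerDr.
- by move=> x a b; apply: ext => n; rewrite scalerDl.
have prE n : exists pr : {linear X -> Y n}, forall x, pr x = g x n.
  have [|pr prE] := @linear_exists R X (Y n) (fun x => g x n); last by exists pr.
  by move=> a x y; rewrite -{1}(gK x) -{1}(gK y) -fZ -fD fK.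
exists X, (fun n => sval (cid (prE n))); split=> [x y xy|x].
  apply: (can_inj gK); apply: ext => n; have := xy n.
  by case: cid => pr /= prE'; rewrite !prE'.
by exists (f x) => n; case: cid => pr /= ->; rewrite fK.
Qed.

Lemma fp_projective_complex (A : lmodType R) (phi : {linear A -> A})
    (Y : nat -> lmodType R) (e : forall n, {linear Y n -> Y n.+1})
    (h : forall n, {linear A -> Y n}) :
  fp_projective A -> (forall x, phi (phi x) = 0) ->
  injective (e 0%N) -> (forall n, exact_at (e n) (e n.+1)) ->
  (forall n, solvable_on (fun x => e n x = 0)) ->
  (forall x, h 0%N (phi x) = 0) ->
  (forall n x, h n.+1 (phi x) = e n (h n x)) ->
  exists s : {linear A -> Y 0%N}, forall x, h 0%N x = s (phi x).
Proof.
move=> fpA phi2 e0 ex sol h0 hS; have [X [pr [prI prT]]] := product_exists Y.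
have tup (V : lmodType R) (f : forall n, {linear V -> Y n}) :
    exists k : {linear V -> X}, forall n x, pr n (k x) = f n x.
  have /choice [k kE] : forall x, exists y, forall n, pr n y = f n x.
    by move=> x; apply: prT.
  have [|k' k'E] := @linear_exists R V X k.
    by move=> a x y; apply: prI => n; rewrite linearP !kE linearP.
  by exists k' => n x; rewrite k'E kE.
(* [d] shifts degrees up by one, with 0 in component 0. Hence injectivity of [e 0] accounts for
   exactness in degree 0, and component 0 of h = d s + s phi is the conclusion. *)
have [d dE] := tup X (fun n => if n is m.+1 then (e m \o pr m)%FUN else \0).
have [hX hE] := tup A h.
have ker_d x : d x = 0 <-> forall n, e n (pr n x) = 0.
  split=> [dx n|ex0]; first by have := dE n.+1 x; rewrite dx linear0 /= => <-.
  by apply: prI => -[|n]; rewrite dE linear0 //= ex0.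
have [|||s sE] := @fp_projective_homotopy R A X phi d hX fpA phi2.
- move=> x; split=> [/ker_d ex0|[y <-]]; last first.
    apply/ker_d => -[|n]; rewrite dE ?linear0 //=.
    by apply/ex; exists (pr n y).
  have H n : exists y, e n y = pr n.+1 x by apply/ex.
  have [y yE] := prT (fun n => sval (cid (H n))); exists y; apply: prI => -[|n].
    by rewrite dE /=; apply: e0; rewrite ex0 linear0.
  by rewrite dE /= yE; case: cid.
- move=> m n r t dt rel.
  have H k : exists z : 'I_n -> Y k, (forall i, e k (z i) = 0) /\
      forall c, comb (c *m r) z = comb c (pr k \o t).
    apply: sol => [j|c cr]; first exact: (ker_d (t j)).1.
    by rewrite -linear_comb rel ?linear0.
  have /choice [z zE] : forall i, exists y, forall k, pr k y = sval (cid (H k)) i.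
    by move=> i; apply: prT.
  exists z; split=> [i|c].
    by apply/ker_d => k; rewrite zE; case: cid => ? [].
  apply: prI => k; rewrite !linear_comb.
  by rewrite -(svalP (cid (H k))).2; apply: eq_comb => i /=; rewrite zE.
- by move=> x; apply: prI => -[|n]; rewrite hE dE ?h0 //= hS hE.
exists (pr 0%N \o s)%FUN => x /=.
by rewrite -hE sE linearD dE /= add0r.
Qed.

(** This is exactness of Hom(A, J) -> Hom(M, J) -> Ext^1(M, J) -> Ext^1(A, J). An extension V of M
    is pulled back along [g] to an extension W of A, where [w] extends to [t]; the kernel of W -> V
    is a copy of M, and subtracting an extension [s] of [t] restricted to it makes t - s p2 descend
    to V. *)
Lemma pullback_Ext1 (J M A : lmodType R) (f : {linear M -> A})
    (g : {linear A -> M}) :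
  short_exact f g -> Ext_eq0 1 A J ->
  (forall u : {linear M -> J}, exists s : {linear A -> J}, forall x, s (f x) = u x) ->
  Ext_eq0 1 M J.
Proof.
move=> [finj fg gs] extA ext_f; apply: extends_Ext1 => U V a b [ainj ab bs] w.
pose N (p : V * A) := b p.1 = g p.2.
have sN : submodule N.
  split=> [|k [x y] [x' y'] h h']; rewrite /N /= ?linear0 //.
  by rewrite !linearP [b x]h [b x']h'.
have [W [i [iinj iE]]] := submodule_exists sN.
have fst_i y : b (i y).1 = g (i y).2 by apply/iE; exists y.
have [|||k kE] := @graph_linear R U W (fun x y => i y = (a x, 0)).
- by move=> x; apply/iE; rewrite /N /= linear0; apply/ab; exists x.
- move=> l x x' y y' h h'; rewrite linearP h h' linearP.
  by congr pair; rewrite /= scaler0 addr0.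
- by move=> y h; apply: iinj; rewrite h !linear0.
have ik x : i (k x) = (a x, 0).
  have [y yE] : exists y, i y = (a x, 0).
    by apply/iE; rewrite /N /= linear0; apply/ab; exists x.
  by rewrite (kE x y yE).
have [|||p2 p2E] := @graph_linear R W A (fun y x => x = (i y).2).
- by move=> y; exists (i y).2.
- by move=> l y y' x x' -> ->; rewrite linearP.
- by move=> x ->; rewrite linear0.
have {}p2E y : p2 y = (i y).2 by apply: p2E.
have exW : short_exact k p2.
  split=> [x x' kx|y|x].
  - by apply: ainj; have := ik x'; rewrite -kx ik => -[].
  - rewrite p2E; split=> [y2|[x <-]]; last by rewrite ik.
    have /ab [x xE] : b (i y).1 = 0 by rewrite fst_i y2 linear0.
    exists x; apply: iinj; rewrite ik xE -y2; by case: (i y).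
  have [v vE] := bs (g x).
  have [y yE] : exists y, i y = (v, x) by apply/iE.
  by exists y; rewrite p2E yE.
have [t tE] := Ext1_extends extA exW w.
have [|||m mE] := @graph_linear R M W (fun x y => i y = (0, f x)).
- by move=> x; apply/iE; rewrite /N /= linear0; apply/esym/fg; exists x.
- move=> l x x' y y' h h'; rewrite linearP h h' linearP.
  by congr pair; rewrite /= scaler0 addr0.
- by move=> y h; apply: iinj; rewrite h !linear0.
have [s sE] := ext_f (t \o m)%FUN.
have [|||v vE] := @graph_linear R V J
    (fun x z => exists2 y, (i y).1 = x & z = t y - s (i y).2).
- move=> x; have [z zE] := gs (b x).
  have [y yE] : exists y, i y = (x, z) by apply/iE; rewrite /N /= zE.
  by exists (t y - s (i y).2), y; rewrite ?yE.
- move=> l x x' z z' [y <- ->] [y' <- ->]; exists (l *: y + y').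
    by rewrite linearP.
  by rewrite !linearP /= scalerDr addrACA.
- move=> z [y y1 ->].
  have /fg [x xE] : g (i y).2 = 0 by rewrite -fst_i y1 linear0.
  have yE : i y = (0, f x) by rewrite xE -y1; case: (i y).
  by rewrite -xE sE /= (mE x y yE) subrr.
exists v => x; rewrite (vE _ (t (k x) - s (i (k x)).2)).
  by rewrite ik linear0 subr0 tE.
by exists (k x); rewrite ?ik.
Qed.

(** * The coresolution attached to a map from the periodic module *)

Section Coresolution.
Variables (M A J : lmodType R) (f : {linear M -> A}) (g : {linear A -> M}).
Hypothesis fg_exact : short_exact f g.

Record stage := Stage {
  stage_mod : lmodType R;
  stage_map : {linear M -> stage_mod};
  stage_strong : strongly_fp_injective stage_mod }.

(** A step is a morphism from the sequence M -> A -> M to an extension of the next cosyzygy by the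
    current one. Because its right end again starts from M, steps can be iterated. *)
Record stage_step (S : stage) := StageStep {
  step_inj : lmodType R;
  step_next : stage;
  step_j : {linear stage_mod S -> step_inj};
  step_q : {linear step_inj -> stage_mod step_next};
  step_v : {linear A -> step_inj};
  step_exact : short_exact step_j step_q;
  step_vf : forall x, step_v (f x) = step_j (stage_map S x);
  step_uq : forall x, stage_map step_next (g x) = step_q (step_v x) }.

Lemma stage_step_exists S : exists s : stage_step S, True.
Proof.
have [finj fg gs] := fg_exact.
have [I [j [jinj injI]]] := injective_embedding (stage_mod S).
have [Z [q [qs qE]]] := quotient_exists (image_submodule j (submoduleT _)).
have ex : short_exact j q.
  split=> // x; split=> [/qE [y _ ->]|[y <-]]; first by exists y.
  by apply/qE; exists y.
have [v vE] := injI _ _ f finj (j \o stage_map S)%FUN.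
have [x gx0|u uE] := linear_factor (f := (q \o v)%FUN) gs.
  have [y <-] := (fg x).1 gx0; rewrite /= vE /=.
  by apply/qE; exists (stage_map S y).
by exists (@StageStep S I (Stage u (strongly_fp_injective_cokernel ex injI
  (stage_strong (s:=S)))) j q v ex vE uE).
Qed.

Definition choose_step S : stage_step S := sval (cid (stage_step_exists S)).

End Coresolution.

End Periodic.

Theorem theorem0p7 (R : pzRingType) (M : lmodType R) :
  periodic (@fp_projective R) M -> weakly_fp_projective M.
Proof.
move=> [A [f [g [fpA ex]]]] J sJ; have [finj fg gs] := ex.
have solJ := strongly_fp_injective_solvable sJ.
apply: (pullback_Ext1 ex) => [|u]; first exact/fpA/solvable_fp_injective.
pose S n := iter n (fun s => step_next (choose_step ex s)) (Stage u sJ).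
pose st n := choose_step ex (S n).
pose Y n := if n is m.+1 then step_inj (st m) else J.
pose e n : {linear Y n -> Y n.+1} :=
  match n with
  | 0%N => step_j (st 0%N)
  | m.+1 => (step_j (st m.+1) \o step_q (st m))%FUN
  end.
pose h n : {linear A -> Y n} :=
  match n with
  | 0%N => (u \o g)%FUN
  | m.+1 => step_v (st m)
  end.
pose phi : {linear A -> A} := (f \o g)%FUN.
have gf x : g (f x) = 0 by apply/fg; exists x.
have jinj n : injective (step_j (st n)) by case: (step_exact (st n)).
have e_ker n x : e n.+1 x = 0 <-> exists y, step_j (st n) y = x.
  have [_ jq _] := step_exact (st n).
  split=> [|/jq qx]; last by rewrite /e /= qx linear0.
  by rewrite /e /= -(linear0 (step_j (st n.+1))) => /jinj /jq.
have [||||||s sE] := @fp_projective_complex R A phi Y e h fpA.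
- by move=> x; rewrite /phi /= gf linear0.
- exact: jinj.
- move=> [|n] x; first exact: e_ker.
  split=> [/e_ker [y <-]|[y <-]]; last by apply/e_ker; exists (step_q (st n) y).
  have [_ _ qs] := step_exact (st n).
  by have [z <-] := qs y; exists z.
(* The kernel of [e 0] is zero, so zero is a solution there. The kernel of [e n.+1] is the image of
   [step_j (st n)], a copy of the cosyzygy in [S n], where the system is solved. *)
- move=> [|n] m k r t te rel.
    exists (fun=> 0); split=> [i|c]; first exact: linear0.
    have -> : comb c t = 0.
      rewrite /comb big1 // => i _; rewrite (_ : t i = 0) ?scaler0 //.
      by apply: (jinj 0%N); rewrite linear0; apply: te.
    by rewrite /comb big1 // => i _; rewrite scaler0.
  have /choice [t' t'E] : forall i, exists y, step_j (st n) y = t i.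
    by move=> i; apply/e_ker.
  have jt c : comb c t = step_j (st n) (comb c t').
    by rewrite linear_comb; apply: eq_comb => i; rewrite /= t'E.
  have [|c cr|z [_ zE]] :=
      strongly_fp_injective_solvable (stage_strong (s := S n)) (r := r) (t := t').
  + by [].
  + by apply: (jinj n); rewrite -jt rel ?linear0.
  exists (step_j (st n) \o z); split=> [i|c]; first by apply/e_ker; exists (z i).
  by rewrite jt -zE linear_comb.
- by move=> x; rewrite /h /phi /= gf linear0.
- move=> [|n] x; rewrite /h /phi /= step_vf //.
  by rewrite -step_uq.
exists s => x; have [y <-] := gs x.
by rewrite -[RHS]/(h 0%N y) sE.
Qed.
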